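(* Let $f\in K^{\times}$ satisfy $L(f)=0$, where $L$ is a nonzero homogeneous linear differential operator with coefficients in $k$ of order $n\geq 2$, and assume that the differential Galois group $G_L$ of $L$ over $k$ is either $\mathrm{SL}_n(C)$ or $\mathrm{GL}_n(C)$. Then $\mathcal{A}(f)=k[f]$.
   Context: $K$ is a differential field of characteristic zero (derivation $y\mapsto y'$), $k\subset K$ is an algebraically closed differential subfield, and $K$ and $k$ have the same field of constants $C$. The differential Galois group of $L$ over $k$ is the group of differential $k$-automorphisms of a Picard–Vessiot extension of $k$ for $L$, viewed as a subgroup of $\mathrm{GL}_n(C)$ via its action on a basis of the solution space of $L$. For $f\in K^{\times}$, $\mathcal{A}(f)$ denotes the $k$-algebra of all $g\in K$ that satisfy some nonzero homogeneous linear differential equation with coefficients in $k$ and are algebraically dependent on $f$ over $k$. *)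

(* Defs.v *)
From HB Require Import structures.
From mathcomp Require Import all_boot all_order all_algebra.
Set Implicit Arguments. Unset Strict Implicit. Unset Printing Implicit Defensive.
Import Order.TTheory GRing.Theory Num.Theory.
Local Open Scope ring_scope.

Definition is_derivation (K : fieldType) (D : K -> K) : Prop :=
  (forall x y, D (x + y) = D x + D y) /\
  (forall x y, D (x * y) = D x * y + x * D y).

Definition is_const (K : fieldType) (D : K -> K) (x : K) : Prop := D x = 0.

Definition is_subfield (K : fieldType) (S : K -> Prop) : Prop :=
  S 0 /\ S 1 /\ (forall x y, S x -> S y -> S (x + y)) /\
  (forall x, S x -> S (- x)) /\ (forall x y, S x -> S y -> S (x * y)) /\
  (forall x, S x -> S x^-1).

Definition is_diff_subfield (K : fieldType) (D : K -> K) (k : K -> Prop) : Prop :=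
  is_subfield k /\ (forall x, k x -> k (D x)).

Definition alg_closed_sub (K : fieldType) (k : K -> Prop) : Prop :=
  forall p : {poly K}, (forall i, k p`_i) -> (1 < size p)%N ->
    exists x, k x /\ root p x.

Definition apply_op (K : fieldType) (D : K -> K) (n : nat) (a : nat -> K) (y : K) : K :=
  \sum_(i < n.+1) a i * iter i D y.

Definition op_over (K : fieldType) (k : K -> Prop) (n : nat) (a : nat -> K) : Prop :=
  (forall i, (i <= n)%N -> k (a i)) /\ a n != 0.

Definition wronskian_mx (M : fieldType) (DM : M -> M) (n : nat) (y : 'I_n -> M)
  : 'M[M]_n := \matrix_(i < n, j < n) iter i DM (y j).

(* Data of a Picard-Vessiot extension of k for L:
   M is a differential field (derivation DM), phi embeds the differential field
   k (subset of K) into M, y_0..y_(n-1) is a fundamental system of solutions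
   of L^phi in M (nonzero Wronskian), M has no new constants, and M is
   generated as a field by phi(k) and the y_j and their derivatives. *)
Definition is_PV_ext (K : fieldType) (D : K -> K) (k : K -> Prop)
  (n : nat) (a : nat -> K)
  (M : fieldType) (DM : M -> M) (phi : K -> M) (y : 'I_n -> M) : Prop :=
  is_derivation DM /\
  (forall x z, k x -> k z -> phi (x + z) = phi x + phi z) /\
  (forall x z, k x -> k z -> phi (x * z) = phi x * phi z) /\
  phi 1 = 1 /\
  (forall x, k x -> phi (D x) = DM (phi x)) /\
  (forall j, \sum_(i < n.+1) phi (a i) * iter i DM (y j) = 0) /\
  \det (wronskian_mx DM y) != 0 /\
  (forall z, DM z = 0 -> exists c, k c /\ z = phi c) /\
  (forall S : M -> Prop, is_subfield S -> (forall x, k x -> S (phi x)) ->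
     (forall (i : nat) j, S (iter i DM (y j))) -> forall z, S z).

Definition is_diff_k_aut (K : fieldType) (k : K -> Prop)
  (M : fieldType) (DM : M -> M) (phi : K -> M) (sigma : M -> M) : Prop :=
  [/\ forall x z, sigma (x + z) = sigma x + sigma z,
      forall x z, sigma (x * z) = sigma x * sigma z,
      bijective sigma,
      forall z, sigma (DM z) = DM (sigma z) &
      forall x, k x -> sigma (phi x) = phi x].

(* A : 'M[K]_n (entries in the constants C of K) is the matrix of some
   differential k-automorphism of M in the basis y of the solution space:
   sigma (y_j) = sum_i A_ij y_i.  The set of such A is the differential
   Galois group G_L viewed inside GL_n(C). *)
Definition in_diff_gal (K : fieldType) (D : K -> K) (k : K -> Prop) (n : nat)
  (M : fieldType) (DM : M -> M) (phi : K -> M) (y : 'I_n -> M) (A : 'M[K]_n) : Prop :=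
  (forall i j, is_const D (A i j)) /\
  exists sigma, is_diff_k_aut k DM phi sigma /\
    forall j, sigma (y j) = \sum_(i < n) phi (A i j) * y i.

Definition in_GL (K : fieldType) (D : K -> K) (n : nat) (A : 'M[K]_n) : Prop :=
  (forall i j, is_const D (A i j)) /\ \det A != 0.
Definition in_SL (K : fieldType) (D : K -> K) (n : nat) (A : 'M[K]_n) : Prop :=
  (forall i j, is_const D (A i j)) /\ \det A = 1.

Definition gal_SL_or_GL (K : fieldType) (D : K -> K) (k : K -> Prop)
  (n : nat) (a : nat -> K) : Prop :=
  exists (M : fieldType) (DM : M -> M) (phi : K -> M) (y : 'I_n -> M),
    is_PV_ext D k a DM phi y /\
    ((forall A, in_diff_gal D k DM phi y A <-> in_SL D A) \/
     (forall A, in_diff_gal D k DM phi y A <-> in_GL D A)).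

Definition diff_finite (K : fieldType) (D : K -> K) (k : K -> Prop) (g : K) : Prop :=
  exists (m : nat) (b : nat -> K), op_over k m b /\ apply_op D m b g = 0.

Definition alg_dep (K : fieldType) (k : K -> Prop) (f g : K) : Prop :=
  exists P : {poly {poly K}}, P != 0 /\ (forall i j, k (P`_i)`_j) /\
    \sum_(i < size P) (P`_i).[f] * g ^+ i = 0.

Definition in_Af (K : fieldType) (D : K -> K) (k : K -> Prop) (f g : K) : Prop :=
  diff_finite D k g /\ alg_dep k f g.

Definition in_kf (K : fieldType) (k : K -> Prop) (f g : K) : Prop :=
  exists p : {poly K}, (forall i, k p`_i) /\ g = p.[f].

(* Main.v *)
(* Write F_i = f^(i) for i < n.

   Independence.  The F_i are algebraically independent over k.  Let y_1..y_n
   be the solutions in the Picard-Vessiot field M.  Substituting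
   X_i = sum_j y_j^(i) Z_j with Z_j constant turns the M-span of the ideal of
   relations between the F_i into a subspace J of M[Z] stable under the
   coefficientwise derivation, so J contains a nonzero polynomial with constant
   coefficients as soon as there is a relation.  The elements 1 - t E_ij of the
   Galois group, for integers t, make the space U of constant elements of J
   stable under Z_i -> Z_i + t Z_j up to J, hence, by interpolation in t, under
   the operators Z_j d/dZ_i.  Such a nonzero U contains all monomials of some
   degree d, whence (sum_j y_j Z_j)^d lies in J; by linear descent from M to k
   this says f^d = 0.

   Polynomiality.  Let E be the algebraic closure in K of k(F_0, F_2, F_3, ...)
   and x = F_1, transcendental over E.  For h in E, D h = alpha + beta x with
   alpha, beta in E, and h |-> beta is a derivation de of E with de f = 1,
   trivial on k.  The coefficient of x^m in D^m g is de^m g, so a linear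
   equation of order m for g in E gives de^m g = 0.  An element h algebraic
   over k(f) with de h = 0 lies in k, and integrating m times shows that g is a
   polynomial in f. *)
Require Import Defs.
From HB Require Import structures.
From mathcomp Require Import all_boot all_order all_algebra.
From mathcomp Require Import boolp.
From mathcomp Require Import mpoly.
Set Implicit Arguments. Unset Strict Implicit. Unset Printing Implicit Defensive.
Import GRing.Theory.
Local Open Scope ring_scope.

(** * Subfields and algebraic elements *)

(** Membership is made boolean by classical logic. The proof [hS] is an argument so that the closure
    instance below can be attached to the predicate. *)
Definition subfield_pred (K : fieldType) (S : K -> Prop) of is_subfield S : {pred K} :=
  fun x => `[<S x>].

Section Subfield.
Variables (K : fieldType) (S : K -> Prop) (hS : is_subfield S).

Lemma subfield_predE x : (x \in subfield_pred hS) = `[<S x>].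
Proof. by []. Qed.

Fact subfield_pred_closed : divring_closed (subfield_pred hS).
Proof.
case: hS => [S0 [S1 [SD [SN [SM SV]]]]].
split=> [|x y|x y]; rewrite !subfield_predE.
- exact/asboolP.
- by move=> /asboolP Sx /asboolP Sy; apply/asboolP/SD => //; apply: SN.
- by move=> /asboolP Sx /asboolP Sy; apply/asboolP/SM => //; apply: SV.
Qed.
HB.instance Definition _ :=
  GRing.isDivringClosed.Build K (subfield_pred hS) subfield_pred_closed.

(** Turns [S] into a field in its own right, so that general results on polynomials, matrices and
    integrality over a field apply to it. *)
Record subfield_type := SubfieldElt {
  subfield_val : K;
  _ : subfield_val \in subfield_pred hS }.

HB.instance Definition _ := [isSub for subfield_val].
HB.instance Definition _ := [Choice of subfield_type by <:].
HB.instance Definition _ := [SubChoice_isSubIntegralDomain of subfield_type by <:].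
HB.instance Definition _ := [SubIntegralDomain_isSubField of subfield_type by <:].

Lemma subfield_valP (x : subfield_type) : S (val x).
Proof. exact/asboolP/(valP x). Qed.

Lemma subfield_elt (z : K) : S z -> exists x : subfield_type, val x = z.
Proof. by move=> /asboolP Sz; exists (SubfieldElt Sz). Qed.
End Subfield.

Lemma map_poly_preimage (F K : fieldType) (iota : {rmorphism F -> K}) (p : {poly K}) :
  (forall i, exists c, iota c = p`_i) -> exists q, map_poly iota q = p.
Proof.
move=> /choice[g gE]; exists (\poly_(i < size p) g i).
apply/polyP => i; rewrite coef_map coef_poly.
case: ltnP => [_|le_pi]; first exact: gE.
by rewrite (nth_default _ le_pi); apply: rmorph0.
Qed.

Lemma deriv_eq0_pchar0 (F : fieldType) (p : {poly F}) :
  [pchar F] =i pred0 -> p^`() = 0 -> (size p <= 1)%N.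
Proof.
move=> /pcharf0P chF dp0; apply/leq_sizeP => -[//|i] _; apply/eqP.
have /eqP : p^`()`_i = 0 by rewrite dp0 coef0.
by rewrite coef_deriv -mulr_natr mulf_eq0 chF orbF.
Qed.

Definition subring_prop (K : fieldType) (R : K -> Prop) : Prop :=
  R 0 /\ R 1 /\ (forall x y, R x -> R y -> R (x + y)) /\
  (forall x, R x -> R (- x)) /\ (forall x y, R x -> R y -> R (x * y)).

Lemma subfield_subring (K : fieldType) (S : K -> Prop) :
  is_subfield S -> subring_prop S.
Proof. by case=> [? [? [? [? [? ?]]]]]; do !split. Qed.

Section SubringTheory.
Variables (K : fieldType) (R : K -> Prop) (hR : subring_prop R).

Lemma subring_sum (I : Type) (s : seq I) (P : pred I) (F : I -> K) :
  (forall i, P i -> R (F i)) -> R (\sum_(i <- s | P i) F i).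
Proof. by case: hR => [R0 [_ [RD _]]] RF; elim/big_ind: _. Qed.

Lemma subring_prod (I : Type) (s : seq I) (P : pred I) (F : I -> K) :
  (forall i, P i -> R (F i)) -> R (\prod_(i <- s | P i) F i).
Proof. by case: hR => [_ [R1 [_ [_ RM]]]] RF; elim/big_ind: _. Qed.

Lemma subring_exp x m : R x -> R (x ^+ m).
Proof. by move=> Rx; rewrite -[m]subn0 -prodr_const_nat; apply: subring_prod. Qed.

Lemma subring_mulrn x m : R x -> R (x *+ m).
Proof. by move=> Rx; rewrite -[m]subn0 -sumr_const_nat; apply: subring_sum. Qed.

Lemma subring_horner (p : {poly K}) x : (forall i, R p`_i) -> R x -> R p.[x].
Proof.
case: (hR) => [_ [_ [_ [_ RM]]]] Rp Rx; rewrite horner_coef.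
by apply: subring_sum => i _; apply: RM => //; apply: subring_exp.
Qed.
End SubringTheory.

Definition frac_of (K : fieldType) (R : K -> Prop) (z : K) : Prop :=
  exists a b, [/\ R a, R b, b != 0 & z = a / b].

(** Coefficients are taken in [R] itself, not in its fraction field; [alg_over_integral] shows that
    this makes no difference. *)
Definition alg_over (K : fieldType) (R : K -> Prop) (z : K) : Prop :=
  exists p : {poly K}, [/\ (forall i, R p`_i), p != 0 & root p z].

Section AlgebraicOverSubring.
Variables (K : fieldType) (R : K -> Prop) (hR : subring_prop R).

Lemma frac_of_subfield : is_subfield (frac_of R).
Proof.
case: hR => [R0 [R1 [RD [RN RM]]]]; do !split.
- by exists 0, 1; split=> //; rewrite ?oner_neq0 ?mul0r.
- by exists 1, 1; split=> //; rewrite ?oner_neq0 ?divr1.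
- move=> _ _ [a [b [Ra Rb b0 ->]]] [c [d [Rc Rd d0 ->]]].
  exists (a * d + c * b), (b * d); split; rewrite ?mulf_neq0 ?addf_div //.
  by apply: RD; apply: RM.
  exact: RM.
- move=> _ [a [b [Ra Rb b0 ->]]]; exists (- a), b.
  by split; rewrite ?mulNr //; apply: RN.
- move=> _ _ [a [b [Ra Rb b0 ->]]] [c [d [Rc Rd d0 ->]]].
  exists (a * c), (b * d); split; rewrite ?mulf_neq0 ?mulf_div //; exact: RM.
- move=> _ [a [b [Ra Rb b0 ->]]]; have [->|a0] := eqVneq a 0.
    by exists 0, 1; split; rewrite ?oner_neq0 ?mul0r ?invr0.
  by exists b, a; split=> //; rewrite invf_div.
Qed.

Lemma common_denominator (p : {poly K}) : (forall i, frac_of R p`_i) ->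
  exists c, [/\ R c, c != 0 & forall i, R (c * p`_i)].
Proof.
case: (hR) => [R0 [R1 [RD [RN RM]]]].
elim/poly_ind: p => [|p c IH] Fp.
  by exists 1; split=> [||i]; rewrite ?oner_neq0 ?coef0 ?mulr0.
have [i|d [Rd d0 dP]] := IH.
  by have := Fp i.+1; rewrite coefD coefMX coefC /= addr0.
have [a [b [Ra Rb b0 cE]]] := Fp 0.
have cE' : c = a / b by rewrite -cE coefD coefMX coefC /= add0r.
exists (d * b); split; rewrite ?mulf_neq0 //; first exact: RM.
case=> [|i]; rewrite coefD coefMX coefC /=.
  by rewrite add0r cE' -mulrA (mulrC b) divfK //; apply: RM.
by rewrite addr0 mulrAC; apply: RM.
Qed.

(** One direction embeds [R] in its fraction field, the other clears a common denominator. Over a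
    field algebraic and integral elements coincide, which gives access to the closure properties of
    integral elements. *)
Lemma alg_over_integral z :
  alg_over R z <->
  integralOver (\val : {rmorphism subfield_type frac_of_subfield -> K}) z.
Proof.
rewrite -integral_algebraic; split=> [[p [Rp p0 pz]]|[p p0 pz]].
  have [i|q qE] := @map_poly_preimage _ _
     (\val : {rmorphism subfield_type frac_of_subfield -> K}) p.
    apply: subfield_elt; exists p`_i, 1; split; rewrite ?oner_neq0 ?divr1 //.
    by case: hR => [_ []].
  by exists q; rewrite ?qE // -(map_poly_eq0 (\val : {rmorphism _ -> K})) qE.
have [i|c [Rc c0 cP]] := @common_denominator
    (map_poly (\val : {rmorphism subfield_type frac_of_subfield -> K}) p).
  by rewrite coef_map; apply: subfield_valP.
exists (c *: map_poly \val p); split=> [i||]; rewrite ?coefZ //.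
  by rewrite scaler_eq0 (negPf c0) map_poly_eq0.
by rewrite /root hornerZ (eqP pz) mulr0.
Qed.

Lemma alg_over_id z : R z -> alg_over R z.
Proof.
case: hR => [R0 [R1 [RD [RN RM]]]] Rz; exists ('X - z%:P).
split; rewrite ?polyXsubC_eq0 ?root_XsubC // => i.
rewrite coefB coefX coefC; apply: RD; first by case: eqP.
by case: eqP => _; rewrite ?oppr0 //; apply: RN.
Qed.

Lemma alg_over_subfield : is_subfield (alg_over R).
Proof.
do !split; move=> *; apply/alg_over_integral.
- exact: integral0.
- exact: integral1.
- by apply: integral_add; apply/alg_over_integral.
- by apply: integral_opp; apply/alg_over_integral.
- by apply: integral_mul; apply/alg_over_integral.
- by apply: integral_inv; apply/alg_over_integral.
Qed.

Lemma alg_over_trans z : alg_over (alg_over R) z -> alg_over R z.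
Proof.
move=> [p [Ep p0 pz]]; apply/alg_over_integral.
by apply: (integral_root p0 pz); apply/integral_poly => i; apply/alg_over_integral.
Qed.

Lemma alg_over_separable z : [pchar K] =i pred0 -> alg_over R z ->
  exists p : {poly K}, [/\ (forall i, R p`_i), root p z & ~~ root p^`() z].
Proof.
move=> chK [p [Rp p0 pz]]; have [m] := ubnP (size p).
elim: m p Rp p0 pz => // m IH p Rp p0 pz /ltnSE-le_pm.
have [dz|ndz] := boolP (root p^`() z); last by exists p.
apply: (IH p^`()) => //; last exact: leq_trans (lt_size_deriv p0) le_pm.
  by move=> i; rewrite coef_deriv; apply: subring_mulrn.
apply: contraTneq (root_size_gt1 p0 pz) => /(deriv_eq0_pchar0 chK).
by rewrite leqNgt => /negPf->.
Qed.
End AlgebraicOverSubring.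

(** * Derivations *)

(** The rules are required on [E] only, because the derivation [de] used below is obtained by choice
    and is arbitrary outside [E]. *)
Definition derivation_on (K : fieldType) (E : K -> Prop) (d : K -> K) : Prop :=
  (forall x y, E x -> E y -> d (x + y) = d x + d y) /\
  (forall x y, E x -> E y -> d (x * y) = d x * y + x * d y).

Section DerivationOn.
Variables (K : fieldType) (E : K -> Prop) (d : K -> K).
Hypotheses (hE : subring_prop E) (hd : derivation_on E d).

Lemma derivation_on0 : d 0 = 0.
Proof.
case: hE hd => [E0 _] [dD _]; have := dD 0 0 E0 E0.
by rewrite addr0 -[LHS]addr0 => /addrI.
Qed.

Lemma derivation_on1 : d 1 = 0.
Proof.
case: hE hd => [_ [E1 _]] [_ dM]; have := dM 1 1 E1 E1.
by rewrite !mulr1 mul1r -[LHS]addr0 => /addrI.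
Qed.

Lemma derivation_onN x : E x -> d (- x) = - d x.
Proof.
case: hE hd => [_ [_ [_ [EN _]]]] [dD _] Ex; apply/eqP.
by rewrite -subr_eq0 opprK -dD ?addNr ?derivation_on0 //; apply: (EN).
Qed.

Lemma derivation_on_sum (I : Type) (s : seq I) (P : pred I) (F : I -> K) :
  (forall i, P i -> E (F i)) ->
  d (\sum_(i <- s | P i) F i) = \sum_(i <- s | P i) d (F i).
Proof.
case: hd => [dD _] EF; elim: s => [|i s IH].
  by rewrite !big_nil derivation_on0.
rewrite !big_cons; case: ifP => // Pi; rewrite dD ?IH //; first exact: EF.
exact: subring_sum.
Qed.

Lemma derivation_on_exp x m : E x -> d (x ^+ m) = x ^+ m.-1 * d x *+ m.
Proof.
case: hd => [_ dM] Ex; elim: m => [|m IH].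
  by rewrite expr0 mulr0n derivation_on1.
rewrite exprS dM //; last exact: subring_exp.
rewrite IH /= mulrnAr mulrA [x ^+ m * _]mulrC mulrC mulrSr addrC [_ * d x]mulrC.
by case: m {IH} => [|m] /=; rewrite ?mulr0n // -exprS; congr (_ + _); rewrite mulrC.
Qed.

Lemma derivation_on_horner (p : {poly K}) z : (forall i, E p`_i) -> E z ->
  d p.[z] = (\poly_(i < size p) d p`_i).[z] + p^`().[z] * d z.
Proof.
case: (hE) (hd) => [_ [_ [_ [_ EM]]]] [_ dM] Ep Ez.
have Ez' m : E (z ^+ m) by apply: subring_exp.
have -> : p^`().[z] = \sum_(i < size p) p`_i * z ^+ i.-1 *+ i.
  rewrite -{1}[p]coefK poly_def raddf_sum horner_sum; apply: eq_bigr => i _ /=.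
  by rewrite derivZ derivXn hornerZ hornerMn hornerXn mulrnAr.
rewrite horner_poly horner_coef derivation_on_sum; last by move=> i _; apply: (EM).
rewrite mulr_suml -big_split /=; apply: eq_bigr => i _.
by rewrite dM // derivation_on_exp // mulrnAr mulrnAl mulrA.
Qed.
End DerivationOn.

Lemma derivation_on_total (K : fieldType) (D : K -> K) :
  is_derivation D -> derivation_on (fun=> True) D.
Proof. by case=> DD DM; split=> *. Qed.

Lemma subring_total (K : fieldType) : @subring_prop K (fun=> True).
Proof. by do !split. Qed.

Lemma constants_subring (K : fieldType) (D : K -> K) :
  is_derivation D -> subring_prop (fun z => D z = 0).
Proof.
move=> hD; have hDt := derivation_on_total hD; case: hD => DD DM; do !split.
- exact: derivation_on0 (subring_total K) hDt.
- exact: derivation_on1 (subring_total K) hDt.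
- by move=> z w dz dw; rewrite DD dz dw addr0.
- by move=> z dz; rewrite (derivation_onN (subring_total K) hDt) // dz oppr0.
- by move=> z w dz dw; rewrite DM dz dw mul0r mulr0 addr0.
Qed.

(** The hypothesis provides one root [y] of [p] in [k]; either [h = y], or [h] is a root of the
    quotient by X - y. The division is done over [subfield_type hk] so that the quotient keeps its
    coefficients in [k]. *)
Lemma alg_closed_alg_over (K : fieldType) (k : K -> Prop) h :
  is_subfield k -> alg_closed_sub k -> alg_over k h -> k h.
Proof.
move=> hk kcl [p [kp p0 ph]]; have [m] := ubnP (size p).
elim: m p kp p0 ph => // m IH p kp p0 ph /ltnSE-le_pm.
have [y [ky py]] := kcl p kp (root_size_gt1 p0 ph).
pose v := (\val : {rmorphism subfield_type hk -> K}).
have [i|p' pE] := @map_poly_preimage _ _ v p; first exact: subfield_elt.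
have [y' yE] := subfield_elt hk ky.
have /factor_theorem[q qE] : root p' y' by rewrite -(fmorph_root v) pE /v /= yE.
have {}pE : p = map_poly v q * ('X - y%:P).
  by rewrite -pE qE rmorphM -yE; congr (_ * _); apply: map_polyXsubC.
move: ph; rewrite pE rootM root_XsubC => /orP[qh|/eqP-> //].
move: p0; rewrite pE mulf_eq0 negb_or => /andP[q0 _].
apply: (IH (map_poly v q)) => //.
  by move=> i; rewrite coef_map; apply: subfield_valP.
by move: le_pm; rewrite pE size_Mmonic ?monicXsubC // size_XsubC addn2.
Qed.

Lemma in_kf_subring (K : fieldType) (k : K -> Prop) f :
  subring_prop k -> subring_prop (in_kf k f).
Proof.
move=> hk; case: (hk) => [k0 [k1 [kD [kN kM]]]]; do !split.
- by exists 0; split=> [i|]; rewrite ?coef0 ?horner0.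
- by exists 1; split=> [i|]; rewrite ?coef1 ?hornerC //; case: eqP.
- move=> _ _ [p [kp ->]] [q [kq ->]]; exists (p + q).
  by split=> [i|]; rewrite ?coefD ?hornerD //; apply: (kD).
- move=> _ [p [kp ->]]; exists (- p).
  by split=> [i|]; rewrite ?coefN ?hornerN //; apply: (kN).
- move=> _ _ [p [kp ->]] [q [kq ->]]; exists (p * q).
  split=> [i|]; rewrite ?coefM ?hornerM //.
  by apply: subring_sum => // j _; apply: (kM).
Qed.

Lemma in_kf_const (K : fieldType) (k : K -> Prop) f c :
  subring_prop k -> k c -> in_kf k f c.
Proof.
move=> hk kc; exists c%:P; split=> [i|]; rewrite ?hornerC ?coefC //.
by case: eqP => // _; case: hk.
Qed.

(** * The derivation of E read off from the coefficient of a transcendental x *)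

Section PartialDerivative.
Variables (K : fieldType) (D : K -> K) (E : K -> Prop) (x : K) (al de : K -> K).
Hypotheses (hD : is_derivation D) (hE : is_subfield E).
Hypothesis x_trans : forall p : {poly K}, (forall i, E p`_i) -> p.[x] = 0 -> p = 0.
Hypothesis DE : forall h, E h -> [/\ E (al h), E (de h) & D h = al h + de h * x].
Variables (u v : K).
Hypotheses (Eu : E u) (Ev : E v) (Dx : D x = u + v * x).

Let hE' : subring_prop E := subfield_subring hE.

(** Since [x] is transcendental, 1 and [x] are linearly independent over [E]. Values of [de] can
    thus be computed from any affine expression of [D h]. *)
Lemma de_unique h a b : E h -> E a -> E b -> D h = a + b * x -> de h = b.
Proof.
case: (hE') => [E0 [_ [ED [EN _]]]] Eh Ea Eb Dh.
have [Eal Ede Dh'] := DE Eh.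
have : ((al h - a)%:P + (de h - b)%:P * 'X) = 0.
  apply: x_trans => [i|].
    rewrite addrC coefD coefMX !coefC; apply: (ED).
      by case: i => [|[|i]] //=; apply: (ED) => //; apply: (EN).
    by case: i => [|i] //=; apply: (ED) => //; apply: (EN).
  rewrite !hornerE mulrBl addrACA -Dh' Dh -opprD subrr //.
move/polyP/(_ 1%N); rewrite coefD coefMX !coefC /= add0r => /eqP.
by rewrite subr_eq0 => /eqP.
Qed.

Lemma derivation_on_de : derivation_on E de.
Proof.
case: (hE') (hD) => [E0 [_ [ED [EN EM]]]] [DD DM].
split=> y z Ey Ez; have [[ay dy Dy] [az dz Dz]] := (DE Ey, DE Ez).
  apply: (@de_unique _ (al y + al z)); try exact: ED.
  by rewrite DD Dy Dz mulrDl addrACA.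
apply: (@de_unique _ (al y * z + y * al z));
  [exact: EM | by apply: (ED); apply: (EM) | by apply: (ED); apply: (EM) |].
by rewrite DM Dy Dz !mulrDl !mulrDr addrACA [de y * x * z]mulrAC !mulrA.
Qed.

(** Each application of [D] raises the degree in [x] by at most one, and only the [de] part of the
    derivatives of the coefficients reaches the new top degree. *)
Lemma iter_D_leading_coef g i : E g ->
  exists p : {poly K}, [/\ (forall j, E p`_j), (size p <= i.+1)%N,
    p`_i = iter i de g & iter i D g = p.[x]].
Proof.
case: (hE') => [E0 [_ [ED [EN EM]]]] Eg.
elim: i => [|i [p [Ep sp pi Dp]]].
  exists g%:P; split; rewrite ?hornerC ?coefC ?size_polyC ?leq_b1 //.
  by move=> j; rewrite coefC; case: eqP.
pose pa := \poly_(j < size p) al p`_j; pose pd := \poly_(j < size p) de p`_j.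
pose w : {poly K} := u%:P + v%:P * 'X.
exists (pa + pd * 'X + p^`() * w).
have Ed j : E p^`()`_j by rewrite coef_deriv; apply: subring_mulrn.
have Euv j : E w`_j.
  rewrite /w coefD coefMX !coefC; apply: (ED); first by case: eqP.
  by case: j => [|[|j]].
have Ea j : E pa`_j by rewrite coef_poly; case: ifP => // _; case: (DE (Ep j)).
have Epd j : E pd`_j by rewrite coef_poly; case: ifP => // _; case: (DE (Ep j)).
have sa : (size pa <= i.+1)%N by apply: leq_trans (size_poly _ _) sp.
have sd : (size pd <= i.+1)%N by apply: leq_trans (size_poly _ _) sp.
have suv : (size w <= 2)%N.
  by apply/leq_sizeP => [[|[|j]]] //= _; rewrite /w coefD coefMX !coefC /= addr0.
have sduv : (size (p^`() * w)%R <= i.+1)%N.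
  have [->|p0] := eqVneq p 0; first by rewrite raddf0 mul0r size_poly0.
  apply: leq_trans (size_polyMleq _ _) _; rewrite -subn1 leq_subLR add1n.
  have sp' := leq_trans (lt_size_deriv p0) sp.
  by apply: leq_trans (leq_add (ltnSE sp') suv) _; rewrite addn2.
split.
- move=> j; rewrite !coefD coefMX; apply: (ED); first apply: (ED) => //.
    by case: j => [|j] /=.
  by rewrite coefM; apply: subring_sum => // l _; apply: (EM).
- rewrite !(leq_trans (size_polyD _ _)) // geq_max; apply/andP; split; last first.
    exact: leq_trans sduv _.
  rewrite (leq_trans (size_polyD _ _)) // geq_max (leq_trans sa) //=.
  by have [->|pd0] := eqVneq pd 0; rewrite ?mul0r ?size_poly0 // size_mulX.
- rewrite !coefD coefMX /= (nth_default 0 sa) (nth_default 0 sduv) add0r addr0.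
  rewrite coef_poly; case: ltnP => [_|le_pi]; first by rewrite pi.
  by rewrite -pi nth_default // (derivation_on0 hE' derivation_on_de).
rewrite iterS Dp.
rewrite (derivation_on_horner (subring_total K) (derivation_on_total hD)) //.
rewrite /w !hornerE -Dx; congr (_ + _).
rewrite !horner_poly mulr_suml -big_split /=; apply: eq_bigr => j _.
by case: (DE (Ep j)) => _ _ ->; rewrite mulrDl mulrAC.
Qed.

(** The equation says that a polynomial over [E] vanishes at [x], so it is zero; its coefficient of
    degree [m] comes from the term of order [m] alone. *)
Lemma D_finite_de_nilpotent g m (b : nat -> K) : E g ->
  (forall i, (i <= m)%N -> E (b i)) -> b m != 0 ->
  \sum_(i < m.+1) b i * iter i D g = 0 -> iter m de g = 0.
Proof.
case: (hE') => [E0 [_ [ED [EN EM]]]] Eg Eb bm0 rel.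
have /choice[P hP] := fun i => @iter_D_leading_coef g i Eg.
pose Q := \sum_(i < m.+1) b i *: P i.
have Q0 : Q = 0.
  apply: x_trans => [j|].
    rewrite coef_sum; apply: subring_sum => // i _; rewrite coefZ.
    by case: (hP i) => Ep _ _ _; apply: (EM) => //; apply: Eb; rewrite -ltnS.
  rewrite horner_sum -[RHS]rel; apply: eq_bigr => i _.
  by case: (hP i) => _ _ _ ->; rewrite hornerZ.
have : Q`_m = 0 by rewrite Q0 coef0.
rewrite coef_sum big_ord_recr /= big1 ?add0r => [|i _].
  case: (hP m) => _ _ <- _; rewrite coefZ => /eqP.
  by rewrite mulf_eq0 (negPf bm0) => /eqP.
by case: (hP i) => _ sp _ _; rewrite coefZ nth_default ?mulr0 // (leq_trans sp).
Qed.
End PartialDerivative.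

(** * Elements algebraic over k(f) *)

Section PolynomialsInF.
Variables (K : fieldType) (k E : K -> Prop) (f : K) (de : K -> K).
Hypotheses (chK : [pchar K] =i pred0) (hk : is_subfield k) (kcl : alg_closed_sub k).
Hypotheses (hE : is_subfield E) (hde : derivation_on E de).
Hypothesis EA : forall z, alg_over (in_kf k f) z -> E z.
Hypotheses (de_k : forall c, k c -> de c = 0) (de_f : de f = 1).

Let hk' : subring_prop k := subfield_subring hk.
Let hE' : subring_prop E := subfield_subring hE.
Let hkf : subring_prop (in_kf k f) := in_kf_subring f hk'.

Let Ekf z : in_kf k f z -> E z.
Proof. by move=> kz; apply/EA/alg_over_id. Qed.
Let Ek z : k z -> E z.
Proof. by move=> kz; apply/Ekf/in_kf_const. Qed.
Let kf_f : in_kf k f f.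
Proof.
by exists 'X; split=> [i|]; rewrite ?hornerX // coefX; case: hk' => k0 [k1 _]; case: eqP.
Qed.

Lemma de_polynomial (p : {poly K}) : (forall i, k p`_i) -> de p.[f] = p^`().[f].
Proof.
move=> kp; rewrite (derivation_on_horner hE' hde) => [|i|]; [|exact: Ek|exact: Ekf].
rewrite de_f mulr1 (_ : \poly_(i < _) _ = 0) ?horner0 ?add0r //.
by apply/polyP => i; rewrite coef_poly coef0 de_k ?if_same.
Qed.

(** Applying [de] to a relation p(f) = 0 gives p'(f) = 0 in lower degree, so p' = 0 by induction and
    [p] is a constant equal to p(f). *)
Lemma transcendental_f (p : {poly K}) : (forall i, k p`_i) -> p.[f] = 0 -> p = 0.
Proof.
have [m] := ubnP (size p); elim: m p => // m IH p /ltnSE-le_pm kp pf0.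
have [//|p0] := eqVneq p 0.
have dp0 : p^`() = 0.
  apply: IH => [|i|]; first exact: leq_trans (lt_size_deriv p0) le_pm.
    by rewrite coef_deriv; apply: subring_mulrn.
  by rewrite -de_polynomial // pf0 (derivation_on0 hE' hde).
have /size1_polyC pE := deriv_eq0_pchar0 chK dp0.
by move: pf0; rewrite pE hornerC => ->.
Qed.

(** Implicit differentiation: for a separable relation [p], [de h] is the quotient by -p'(h) of the
    value at [h] of [p] with its coefficients derived. *)
Lemma alg_over_de h : alg_over (in_kf k f) h -> alg_over (in_kf k f) (de h).
Proof.
have [A0 [_ [AD [AN [AM AV]]]]] := alg_over_subfield hkf.
have hA : subring_prop (alg_over (in_kf k f)) by apply/subfield_subring/alg_over_subfield.
move=> Ah; have [p [kfp ph dph]] := alg_over_separable hkf chK Ah.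
have := derivation_on_horner hE' hde (fun i => Ekf (kfp i)) (EA Ah).
rewrite (eqP ph) (derivation_on0 hE' hde) => /esym/eqP.
rewrite addrC addr_eq0 => /eqP deE.
have -> : de h = (p^`().[h])^-1 * - (\poly_(i < size p) de p`_i).[h].
  by rewrite -deE mulKf.
apply: (AM); [apply: AV|apply: AN]; apply: subring_horner => // i; apply: alg_over_id => //.
  by rewrite coef_deriv; apply: subring_mulrn.
rewrite coef_poly; case: ifP => _; last by case: hkf.
have [q [kq ->]] := kfp i; rewrite de_polynomial //.
by exists q^`(); split=> // j; rewrite coef_deriv; apply: subring_mulrn.
Qed.

(* Applying [de] to an algebraic relation [sum_i P_i(f) h^i = 0] differentiates
   the [P_i], since [de h = 0]; after finitely many steps they are constant. *)
Lemma de_constant_relation d N (P : nat -> {poly K}) h : E h -> de h = 0 ->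
  (forall i j, k (P i)`_j) -> (forall i, (i < N)%N -> (size (P i) <= d)%N) ->
  (exists i, (i < N)%N && (P i != 0)) ->
  \sum_(i < N) (P i).[f] * h ^+ i = 0 -> k h.
Proof.
move=> Eh dh0; elim: d P => [|d IH] P kP leP [i0 /andP[i0N Pi0]] rel.
  by move: (leP _ i0N); rewrite leqn0 size_poly_eq0 (negPf Pi0).
have kdP i j : k (P i)^`()`_j by rewrite coef_deriv; apply: subring_mulrn.
have drel : \sum_(i < N) (P i)^`().[f] * h ^+ i = 0.
  rewrite -[RHS](derivation_on0 hE' hde) -[in RHS]rel (derivation_on_sum hE' hde) => [|i _].
    apply: eq_bigr => i _; case: (hde) => _ ->.
    - rewrite (derivation_on_exp hE' hde) // dh0 mulr0 mul0rn mulr0 addr0.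
      by rewrite de_polynomial.
    - by apply: Ekf; exists (P i).
    - exact: subring_exp.
  case: (hE') => _ [_ [_ [_ EM]]]; apply: EM; last exact: subring_exp.
  by apply: Ekf; exists (P i).
have [nz|/forallNP dP0] := pselect (exists i, (i < N)%N && ((P i)^`() != 0)).
  apply: (IH (fun i => (P i)^`())) => // i iN.
  have [->|Pi] := eqVneq (P i) 0; first by rewrite raddf0 size_poly0.
  by rewrite -ltnS (leq_trans (lt_size_deriv Pi)) ?leP.
have constP i : (i < N)%N -> P i = ((P i)`_0)%:P.
  move=> iN; apply/size1_polyC/(deriv_eq0_pchar0 chK)/eqP.
  by have /negP := dP0 i; rewrite iN negbK.
apply: (alg_closed_alg_over hk kcl); exists (\poly_(i < N) (P i)`_0); split=> [i||].
- by rewrite coef_poly; case: ifP => // _; case: hk'.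
- apply: contraNneq Pi0 => /polyP/(_ i0); rewrite coef_poly i0N coef0 => P0.
  by rewrite constP // P0.
- rewrite /root horner_poly -[X in _ == X]rel; apply/eqP/eq_bigr => i _.
  by rewrite [P i in RHS]constP // hornerC.
Qed.

Lemma de_constant h : alg_over (in_kf k f) h -> de h = 0 -> k h.
Proof.
move=> Ah dh0; have Eh := EA Ah; have [p [kfp p0 ph]] := Ah.
have [P /all_and2[kP PE]] := choice kfp.
have PI : exists i, (i < size p)%N && (P i != 0).
  exists (size p).-1; rewrite prednK ?size_poly_gt0 // leqnn /=.
  apply: contraNneq p0 => P0; rewrite -lead_coef_eq0 lead_coefE PE P0.
  by rewrite horner0.
have {ph} : \sum_(i < size p) (P i).[f] * h ^+ i = 0.
  by rewrite -[RHS](eqP ph) horner_coef; apply: eq_bigr => i _; rewrite PE.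
apply: (de_constant_relation (d := \max_(i < size p) size (P i)) _ _ _ _ PI) => //.
by move=> i ip; apply: (leq_bigmax (Ordinal ip)).
Qed.

(** By induction [de h] is some p(f). For an antiderivative q of p, h - q(f) is killed by [de] and
    algebraic over k(f), hence lies in [k]. *)
Lemma de_nilpotent m h : alg_over (in_kf k f) h -> iter m de h = 0 -> in_kf k f h.
Proof.
have [A0 [_ [AD [AN [AM AV]]]]] := alg_over_subfield hkf.
elim: m h => [|m IH] h Ah; first by move=> /= ->; case: hkf.
rewrite iterSr => /IH[]; first exact: alg_over_de.
(* The coefficient of index 0 is a division by zero, which yields 0; the other divisions are
   legitimate in characteristic zero. *)
move=> p [kp deh]; pose q := \poly_(i < (size p).+1) (p`_i.-1 / i%:R).
have k_nat i : k i%:R by apply: subring_mulrn => //; case: hk' => _ [].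
have kq i : k q`_i.
  case: hk => k0 [_ [_ [_ [kM kV]]]].
  by rewrite coef_poly; case: ifP => // _; apply: kM => //; apply: kV.
have dq : q^`() = p.
  apply/polyP => i; rewrite coef_deriv coef_poly /= ltnS.
  case: ltnP => [_|le_pi]; last by rewrite mul0rn nth_default.
  by rewrite -[LHS]mulr_natr divfK // ((pcharf0P K).1 chK).
have kfq : in_kf k f q.[f] by exists q.
have kfqN : in_kf k f (- q.[f]) by case: hkf => _ [_ [_ [kfN _]]]; apply: kfN.
rewrite -(subrK q.[f] h); case: (hkf) => _ [_ [kfD _]]; apply: (kfD) => //.
apply: in_kf_const => //; apply: de_constant.
  by apply: (AD) => //; apply: alg_over_id.
case: (hde) => deD _; rewrite deD; [|exact: EA|exact: Ekf].
by rewrite (derivation_onN hE' hde) ?de_polynomial ?dq ?deh ?subrr //; apply: Ekf.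
Qed.

(** Evaluating the coefficients of [P] at [f] does not kill its leading coefficient, because [f] is
    transcendental over [k]. *)
Lemma alg_dep_alg_over g : alg_dep k f g -> alg_over (in_kf k f) g.
Proof.
move=> [P [P0 [kP Pfg]]]; exists (\poly_(i < size P) (P`_i).[f]); split=> [i||].
- rewrite coef_poly; case: ifP => _; last by case: hkf.
  by exists P`_i.
- apply: contraNneq P0 => /polyP/(_ (size P).-1); rewrite coef_poly coef0.
  case: ltnP => [_|]; last first.
    by rewrite -lead_coef_eq0 lead_coefE => /(nth_default 0)->.
  by move/(transcendental_f (kP _)); rewrite -lead_coef_eq0 => /eqP.
- by rewrite /root horner_poly Pfg.
Qed.
End PolynomialsInF.

(** * Solutions whose derivatives are independent *)

Lemma eq_mmap (n : nat) (R S : nzRingType) (f g : R -> S) (h l : 'I_n -> S) p :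
  f =1 g -> h =1 l -> mmap f h p = mmap g l p.
Proof.
move=> fg hl; apply: eq_bigr => m _; rewrite fg; congr (_ * _).
exact: mmap1_eq.
Qed.

Lemma rmorph_mmap (n : nat) (R S T : nzRingType) (f : R -> S) (h : 'I_n -> S)
    (g : {rmorphism S -> T}) p :
  g (mmap f h p) = mmap (g \o f) (g \o h) p.
Proof.
rewrite rmorph_sum; apply: eq_bigr => m _; rewrite rmorphM rmorph_prod.
by congr (_ * _); apply: eq_bigr => i _; rewrite rmorphXn.
Qed.

Section GenericSolution.
Variables (K F : fieldType) (iota : {rmorphism F -> K}) (D : K -> K) (k : K -> Prop).
Variables (n' : nat) (a : nat -> K) (f : K).
Local Notation n := n'.+2.
Hypotheses (chK : [pchar K] =i pred0) (hD : is_derivation D).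
Hypotheses (hk : is_diff_subfield D k) (kcl : alg_closed_sub k).
Hypothesis kE : forall z, k z <-> exists c, iota c = z.
Hypotheses (ka : op_over k n a) (Lf : apply_op D n a f = 0).
Hypothesis indep : forall Q : {mpoly F[n]},
  mmap iota (fun i : 'I_n => iter i D f) Q = 0 -> Q = 0.

Let hk' : subring_prop k := subfield_subring hk.1.
Let hDt := derivation_on_total hD.
Let x := D f.
Let w (i : 'I_n) : {poly K} := if i == 1%N :> nat then 'X else (iter i D f)%:P.

(** This is k[F_0, F_2, ..., F_(n-1)], where F_i = [iter i D f]: [w] keeps F_1 as an indeterminate
    and replaces the other variables by their values, and a constant result means that F_1 does not
    occur. *)
Definition coef_ring (z : K) : Prop :=
  exists q : {mpoly F[n]}, mmap (polyC \o iota) w q = z%:P.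
Let R := coef_ring.
Let E := alg_over R.

Lemma coef_ring_subring : subring_prop coef_ring.
Proof.
do !split.
- by exists 0; rewrite !rmorph0.
- by exists 1; rewrite !rmorph1.
- by move=> y z [p py] [q qz]; exists (p + q); rewrite !rmorphD /= py qz.
- by move=> y [p py]; exists (- p); rewrite !rmorphN /= py.
- by move=> y z [p py] [q qz]; exists (p * q); rewrite !rmorphM /= py qz.
Qed.
Let hR := coef_ring_subring.
Let hE : is_subfield E := alg_over_subfield hR.
Let hE' : subring_prop E := subfield_subring hE.

Let RE z : R z -> E z.
Proof. exact: alg_over_id. Qed.

Let R_k c : k c -> R c.
Proof. by move=> /kE[b <-]; exists b%:MP; rewrite mmapC. Qed.

Let R_iter i : (i < n)%N -> i != 1%N -> R (iter i D f).
Proof.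
move=> ltin i1; exists 'X_(Ordinal ltin).
by rewrite mmapX mmap1U /w /= (negPf i1).
Qed.

Let ev_mmap q : (mmap (polyC \o iota) w q).[x] = mmap iota (fun i : 'I_n => iter i D f) q.
Proof.
rewrite -[LHS]/(horner_eval x _) rmorph_mmap; apply: eq_mmap => [c|i] /=.
  by rewrite /horner_eval hornerC.
by rewrite /horner_eval /w; case: eqP => [->|_]; rewrite ?hornerX ?hornerC.
Qed.

(** By transitivity a relation over [E] gives one over [R]. Lifting its coefficients to polynomials
    in n variables turns it into a relation between the F_i, which [indep] forbids. *)
Lemma derivative_transcendental (p : {poly K}) :
  (forall i, E p`_i) -> p.[x] = 0 -> p = 0.
Proof.
move=> Ep px; apply/eqP/negPn/negP => p0.
have [r [Rr r0 rx]] : alg_over R x.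
  by apply: alg_over_trans => //; exists p; split=> //; apply/eqP.
case/negP: r0; have /choice[Q QE] := Rr.
pose P := \sum_(i < size r) Q i * 'X_(inord 1) ^+ i.
have PE : mmap (polyC \o iota) w P = r.
  rewrite rmorph_sum -[RHS]coefK poly_def; apply: eq_bigr => i _.
  by rewrite rmorphM rmorphXn /= QE mmapX mmap1U /w inordK // mul_polyC.
have P0 : P = 0 by apply: indep; rewrite -ev_mmap PE (eqP rx).
by rewrite -PE P0 rmorph0.
Qed.

Definition affine_in_derivative (z : K) : Prop :=
  exists al be, [/\ E al, E be & z = al + be * x].
Let lin := affine_in_derivative.

Let linD y z : lin y -> lin z -> lin (y + z).
Proof.
case: hE' => [_ [_ [ED _]]] [a1 [b1 [Ea1 Eb1 ->]]] [a2 [b2 [Ea2 Eb2 ->]]].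
by exists (a1 + a2), (b1 + b2); split; [exact: ED|exact: ED|rewrite mulrDl addrACA].
Qed.
Let linM c z : E c -> lin z -> lin (c * z).
Proof.
case: hE' => [_ [_ [_ [_ EM]]]] Ec [a1 [b1 [Ea1 Eb1 ->]]].
by exists (c * a1), (c * b1); split; [exact: EM|exact: EM|rewrite mulrDr mulrA].
Qed.
Let linE z : E z -> lin z.
Proof. by move=> Ez; exists z, 0; split=> //; rewrite ?mul0r ?addr0 //; case: hE'. Qed.
Let lin0 : lin 0. Proof. by apply: linE; case: hE'. Qed.
Let lin_x : lin x.
Proof. by exists 0, 1; rewrite mul1r add0r; case: hE' => ? [? _]. Qed.
Let lin_sum I (s : seq I) (P : pred I) (G : I -> K) :
  (forall i, P i -> lin (G i)) -> lin (\sum_(i <- s | P i) G i).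
Proof. by move=> lG; elim/big_ind: _. Qed.

Let lin_iter i : (i <= n)%N -> lin (iter i D f).
Proof.
have lt_n j : (j < n)%N -> lin (iter j D f).
  by move=> ltj; have [->|j1] := eqVneq j 1%N; [exact: lin_x|apply/linE/RE/R_iter].
(* The derivative of order n is expressed by the equation through the lower ones. *)
rewrite leq_eqVlt => /orP[/eqP->|]; last exact: lt_n.
have [kai an0] := ka; have := Lf; rewrite /apply_op big_ord_recr /= => /eqP.
rewrite addrC addr_eq0 => /eqP anE; rewrite -[D _](mulKf an0) anE.
have [_ [_ [_ [_ [_ kV]]]]] := hk.1.
apply: linM; first by apply/RE/R_k/kV/kai.
rewrite -mulN1r; apply: linM; first by case: hE' => ? [? [? [EN ?]]]; apply: EN.
apply: lin_sum => i' _; apply: linM; last exact: lt_n.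
by apply/RE/R_k/kai/ltnW.
Qed.

Let D_R z : R z -> lin (D z).
Proof.
move=> [q qz].
(* Setting the indeterminate to 0 writes [z] as a polynomial in the F_i with F_1 replaced by 0. *)
have -> : z = mmap iota (fun i => (w i).[0]) q.
  have := congr1 (horner_eval 0) qz; rewrite rmorph_mmap /horner_eval hornerC => <-.
  by apply: eq_mmap => c //=; rewrite /horner_eval hornerC.
(* By the Leibniz rule [S] is a ring, so it suffices that it contains [k] and the F_i with i
   different from 1. *)
pose S y := E y /\ lin (D y).
have hS : subring_prop S.
  case: hE' hD => [E0 [E1 [ED [EN EM]]]] [DD DM]; do !split=> //.
  - by rewrite (derivation_on0 (subring_total K) hDt).
  - by rewrite (derivation_on1 (subring_total K) hDt).
  - by case: H H0 => ? ? [? ?]; apply: ED.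
  - by case: H H0 => ? ? [? ?]; rewrite DD; apply: linD.
  - by case: H => ? ?; apply: EN.
  - case: H => ? ?; rewrite (derivation_onN (subring_total K) hDt) // -mulN1r.
    by apply: linM => //; apply: EN.
  - by case: H H0 => ? ? [? ?]; apply: EM.
  - case: H H0 => ? ? [? ?]; rewrite DM; apply: linD; last exact: linM.
    by rewrite mulrC; apply: linM.
suff [] : S (mmap iota (fun i => (w i).[0]) q) by [].
have [_ [_ [_ [_ SM]]]] := hS.
apply: subring_sum => // m _; apply: SM.
  have kc : k (iota q@_m) by apply/kE; exists q@_m.
  by split; [exact/RE/R_k|apply/linE/RE/R_k; case: hk => _; apply].
apply: subring_prod => // i _; apply: subring_exp => //; rewrite /w.
case: eqP => [_|/eqP i1]; first by rewrite hornerX; case: hS.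
by rewrite hornerC; split; [exact/RE/R_iter|exact: (@lin_iter i.+1)].
Qed.

(** Implicit differentiation again: by [D_R] the derivatives of the coefficients of a separable
    relation are affine in [x], and [D h] is an [E]-linear combination of them. *)
Let D_E h : E h -> exists albe : K * K, [/\ E albe.1, E albe.2 & D h = albe.1 + albe.2 * x].
Proof.
move=> Eh; have [p [Rp ph dph]] := alg_over_separable hR chK Eh.
have [_ [_ [_ [EN [_ EV]]]]] := hE.
have := derivation_on_horner (subring_total K) hDt (fun=> I) (I : (fun=> True) h) (p := p).
rewrite (eqP ph) (derivation_on0 (subring_total K) hDt) => /esym/eqP.
rewrite addrC addr_eq0 => /eqP DhE.
suff [al [be [? ? ?]]] : lin (D h) by exists (al, be).
rewrite -(mulKf dph (D h)) DhE -mulN1r mulrA horner_poly; apply: linM.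
  case: hE' => _ [E1 [_ [_ EM]]]; apply: EM; last exact: EN.
  apply: EV; apply: subring_horner => // i; apply: RE.
  by rewrite coef_deriv; apply: (subring_mulrn hR).
apply: lin_sum => i _; rewrite mulrC; apply: linM; first exact: subring_exp.
exact/D_R/Rp.
Qed.

Lemma D_finite_algebraic_polynomial g : in_Af D k f g -> in_kf k f g.
Proof.
case=> [[m [b [[kb bm0] relg]]] depg].
have EA z : alg_over (in_kf k f) z -> E z.
  move=> [p [kfp p0 pz]]; exists p; split=> // i.
  have [q [kq ->]] := kfp i; apply: subring_horner => //; last exact: (@R_iter 0).
  by move=> j; apply: R_k.
have /choice[ad adE] : forall h, exists albe : K * K,
    E h -> [/\ E albe.1, E albe.2 & D h = albe.1 + albe.2 * x].
  (* Outside [E] the pair (0, 0) is a default that makes the choice total. *)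
  move=> h; have [Eh|nEh] := pselect (E h); last by exists (0, 0).
  by have [albe ?] := D_E Eh; exists albe.
pose de h := (ad h).2.
(* [D x] is F_2, which is affine in [x] since n is at least 2; for n = 2 this uses the equation. *)
have [u [v [Eu Ev Dx]]] : lin (D x) by apply: (@lin_iter 2).
have tr := derivative_transcendental.
have hde : derivation_on E de := derivation_on_de hD hE tr adE.
have E0 : E 0 by case: hE'. have E1 : E 1 by case: hE' => ? [].
have de_k c : k c -> de c = 0.
  move=> kc; apply: (de_unique hE tr adE (a := D c)) => //.
  - exact/RE/R_k.
  - by apply/RE/R_k; case: hk => _; apply.
  - by rewrite mul0r addr0.
have de_f : de f = 1.
  apply: (de_unique hE tr adE (a := 0)) => //; first exact/RE/(@R_iter 0).
  by rewrite mul1r add0r.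
have Ag := alg_dep_alg_over chK hk.1 hE hde EA de_k de_f depg.
apply: (de_nilpotent chK hk.1 kcl hE hde EA de_k de_f (m := m) Ag).
apply: (D_finite_de_nilpotent hD hE tr adE Eu Ev Dx (EA _ Ag) _ bm0 relg).
by move=> i im; apply/RE/R_k/kb.
Qed.
End GenericSolution.

(** * Submodules of multivariate polynomials *)

Lemma mpoly_ring_ind (n : nat) (R : nzRingType) (P : {mpoly R[n]} -> Prop) :
  (forall c, P c%:MP) -> (forall i, P 'X_i) ->
  (forall p q, P p -> P q -> P (p + q)) -> (forall p q, P p -> P q -> P (p * q)) ->
  forall p, P p.
Proof.
move=> PC PX PD PM p; rewrite [p]mpolyE.
elim/big_ind: _ => [||m _]; [by rewrite -mpolyC0; apply: (PC) | exact: (PD) |].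
rewrite -mul_mpolyC; apply: (PM); first exact: (PC).
rewrite mpolyXE_id; elim/big_ind: _ => [||i _]; [|exact: (PM)|].
  by rewrite -mpolyC1; apply: (PC).
elim: (m i) => [|l IH]; first by rewrite expr0 -mpolyC1; apply: (PC).
by rewrite exprS; apply: (PM).
Qed.

Lemma mpoly_neq0_coef (n : nat) (R : nzRingType) (p : {mpoly R[n]}) :
  p != 0 -> exists m, p@_m != 0.
Proof. by move=> p0; exists (mlead p); rewrite mleadc_eq0. Qed.

Lemma mderiv_eq0_const (n : nat) (M : fieldType) (p : {mpoly M[n]}) :
  [pchar M] =i pred0 -> (forall i, p^`M(i) = 0) -> p = (p@_0)%:MP.
Proof.
move=> /pcharf0P chM dp; apply/mpolyP => m; rewrite mcoeffC.
have [->|m0] := eqVneq m 0%MM; first by rewrite mulr1.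
rewrite mulr0; have /existsP[i mi] : [exists i, m i != 0%N].
  rewrite -negb_forall; apply: contra m0 => /forallP m0.
  by apply/eqP/mnmP => i; rewrite mnm0E; apply/eqP.
have /eqP : (p^`M(i))@_(m - U_(i)) = 0 by rewrite dp mcoeff0.
rewrite mcoeff_mderiv submK ?lep1mP // -mulr_natr mulf_eq0 chM orbF.
by move/eqP.
Qed.

Section Submodule.
Variables (n : nat) (M : fieldType) (S : {mpoly M[n]} -> Prop).
Hypothesis chM : [pchar M] =i pred0.
Hypotheses (SD : forall p q, S p -> S q -> S (p + q)) (SZ : forall c p, S p -> S (c *: p)).

Lemma submodule_sum (I : Type) (s : seq I) (P : pred I) (G : I -> {mpoly M[n]}) :
  S 0 -> (forall i, P i -> S (G i)) -> S (\sum_(i <- s | P i) G i).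
Proof. by move=> S0 SG; elim/big_ind: _. Qed.

(** Interpolation by repeated division: with c = p(N) and p = q (X - N) + c, the values q(t) = (p(t)
    - c) / (t - N) lie in [S] for t > N. The bound [N] is general so that the induction can pass to
    [q] with [N.+1]. *)
Lemma coef_in_submodule (p : {poly {mpoly M[n]}}) N :
  (forall t : nat, (N <= t)%N -> S p.[t%:R]) -> forall i, S p`_i.
Proof.
have [d] := ubnP (size p); elim: d p N => // d IH p N /ltnSE-le_pd Sp.
have SN q : S q -> S (- q) by move=> Sq; rewrite -scaleN1r; apply: (SZ).
have [c cE] : exists c, c = p.[N%:R] by eexists.
have Sc : S c by rewrite cE; apply: Sp.
have [q qE] : exists q, p = q * ('X - N%:R%:P) + c%:P.
  have /factor_theorem[q qE] : root (p - c%:P) N%:R by rewrite /root !hornerE -cE subrr.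
  by exists q; rewrite -qE subrK.
have Sq : forall i, S q`_i.
  have [->|q0] := eqVneq q 0.
    by move=> i; rewrite coef0 -(scale0r c); apply: (SZ).
  apply: (IH q N.+1) => [|t Nt].
    have sq : size (q * ('X - N%:R%:P))%R = (size q).+1.
      by rewrite size_Mmonic ?monicXsubC // size_XsubC addn2.
    apply: leq_trans le_pd; rewrite qE size_polyDl sq // size_polyC ltnS.
    by apply: leq_trans (leq_b1 _) _; rewrite size_poly_gt0.
  have tN0 : (t - N)%:R != 0 :> M.
    by rewrite ((pcharf0P M).1 chM) subn_eq0 -ltnNge.
  have -> : q.[t%:R] = ((t - N)%:R^-1 : M) *: (p.[t%:R] - c).
    have -> : p.[t%:R] - c = ((t - N)%:R : M) *: q.[t%:R].
      rewrite [RHS]scaler_nat -[RHS]mulr_natr qE !hornerE addrK natrB //.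
      exact: ltnW.
    by rewrite scalerA mulVf // scale1r.
  by apply: (SZ); apply: (SD); [apply: Sp; exact: ltnW|apply: (SN)].
move=> i; rewrite qE coefD mulrBr coefB coefMX coefMC coefC.
have S0 : S 0 by rewrite -(scale0r q`_0); apply: (SZ).
apply: (SD); last by case: ifP.
apply: (SD); first by case: ifP.
by apply: (SN); rewrite mulr_natr -scaler_nat; apply: (SZ).
Qed.
End Submodule.

(** Linear systems over [F] acquire no new solvability over [M]. The proof is Gaussian elimination
    on the list of generators. *)
Lemma span_descent (n : nat) (F M : fieldType) (phi : {rmorphism F -> M})
    (I : {mpoly F[n]} -> Prop) (s : seq (M * {mpoly F[n]})) t :
  I 0 -> (forall p q, I p -> I q -> I (p + q)) -> (forall c p, I p -> I (c *: p)) ->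
  (forall p, p \in s -> I p.2) ->
  map_mpoly phi t = \sum_(p <- s) p.1 *: map_mpoly phi p.2 -> I t.
Proof.
move=> I0 ID IZ; have [m] := ubnP (size s); elim: m s t => // m IH [|[c q] s] t.
  move=> _ _; rewrite big_nil => t0; suff -> : t = 0 by [].
  by apply/mpolyP => l; apply: (fmorph_inj phi); rewrite -mcoeff_map_mpoly t0 !mcoeff0 rmorph0.
rewrite ltnS => lt_sm Is tE; have Iq : I q by apply: (Is (c, q)); rewrite mem_head.
have Is' p : p \in s -> I p.2 by move=> ps; apply: Is; rewrite inE ps orbT.
have [q0|q0] := eqVneq q 0.
  apply: (IH s) => //; rewrite tE big_cons /= q0 raddf0 scaler0 add0r //.
have [l ql] := mpoly_neq0_coef q0.
(* [g] clears the coefficient at [l] by means of [q]. Comparing these coefficients in the relation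
   makes the [q] term cancel, leaving a shorter combination for [g t]. *)
pose g p := p - (p@_l / q@_l) *: q.
have -> : t = g t + (t@_l / q@_l) *: q by rewrite subrK.
apply: (ID); last exact: (IZ).
apply: (IH [seq (p.1, g p.2) | p <- s]); first by rewrite size_map.
  move=> _ /mapP[p ps ->] /=; rewrite /g -scaleNr.
  by apply: (ID); [exact: Is' | exact: (IZ)].
have phi_g p : map_mpoly phi (g p) = map_mpoly phi p - (phi p@_l / phi q@_l) *: map_mpoly phi q.
  by rewrite /g raddfB /= map_mpolyZ rmorphM fmorphV.
have phi_q0 : phi q@_l != 0 by rewrite fmorph_eq0.
move: tE; rewrite big_cons phi_g big_map /= => tE.
under eq_bigr do rewrite phi_g scalerBr scalerA.
rewrite sumrB -scaler_suml; have := congr1 (mcoeff l) tE.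
rewrite mcoeffD mcoeffZ !mcoeff_map_mpoly raddf_sum /=.
under eq_bigr do rewrite mcoeffZ mcoeff_map_mpoly.
move=> tlE; rewrite tE tlE mulrDl mulfK // scalerDl [c *: _ + _]addrC opprD addrA addrK.
congr (_ - _ *: _); rewrite mulr_suml; apply: eq_bigr => p _.
by rewrite mulrA.
Qed.

(** * Polynomials under the operators X_j d/dX_i *)

Section LieStable.
Variables (n' : nat) (M : fieldType).
Local Notation n := n'.+2.
Variable U : {mpoly M[n]} -> Prop.
Hypothesis chM : [pchar M] =i pred0.
(** Polynomials with constant coefficients are not stable under all scalars of [M], but a monomial
    always has coefficients 0 and 1, so its scalar can be removed. *)
Hypothesis UZ : forall (c : M) m, c != 0 -> U (c *: 'X_[m]) -> U 'X_[m].
Hypothesis Ushift : forall i j u, i != j -> U u -> U ('X_j * u^`M(i)).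

Let i0 : 'I_n := ord0.
Let i1 : 'I_n := lift ord0 ord0.

(** Since l differs from z, X_z d/dX_l sends X_z^r w to X_z^(r+1) dw/dX_l. The degree of the
    cofactor drops until no variable of [P] is left; the last clause records that absent variables
    stay absent. *)
Lemma eliminate_variables (z : 'I_n) (P : pred 'I_n) r w :
  ~~ P z -> w != 0 -> U ('X_z ^+ r * w) ->
  exists r' w', [/\ w' != 0, U ('X_z ^+ r' * w'), forall l, P l -> w'^`M(l) = 0 &
    forall l, w^`M(l) = 0 -> w'^`M(l) = 0].
Proof.
move=> Pz; have : forall m, w@_m != 0 -> (mdeg m < msize w)%N.
  by move=> m; rewrite -mcoeff_msupp; apply: msize_mdeg_lt.
move: (msize w) => N; elim: N r w => [|d IH] r w wd w0 Uw.
  by have [m /wd] := mpoly_neq0_coef w0.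
have [[l [Pl dw]]|noP] := pselect (exists l, P l /\ w^`M(l) != 0); last first.
  exists r, w; split=> // l Pl; apply/eqP/negPn/negP => dw.
  by apply: noP; exists l.
have lz : l != z by apply: contraNneq Pz => <-.
have [||r' [w' [? ? ? dw']]] := IH r.+1 w^`M(l) _ dw.
- move=> m; rewrite mcoeff_mderiv => dwm; have /wd : w@_(m + U_(l)) != 0.
    by apply: contraNneq dwm => ->; rewrite mul0rn.
  by rewrite mdegD mdeg1 addn1.
- have -> : 'X_z ^+ r.+1 * w^`M(l) = 'X_z * ('X_z ^+ r * w)^`M(l).
    rewrite mderivM (_ : ('X_z ^+ r)^`M(l) = 0) ?mul0r ?add0r ?exprS ?mulrA //.
    rewrite mpolyXn mderivX mulmnE mnm1E eq_sym (negPf lz) mul0n scale0r //.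
  exact: Ushift.
exists r', w'; split=> // k dwk; apply: dw'.
by rewrite mderiv_comm dwk mderiv0.
Qed.

Lemma contains_monomials u : u != 0 -> U u ->
  exists d, forall m : 'X_{1..n}, mdeg m = d -> U 'X_[m].
Proof.
move=> u0 Uu.
(* First all variables other than ['X_i0] are removed from the cofactor, then ['X_i0] is traded for
   ['X_i1]; a nonzero constant times a power of ['X_i1] remains. *)
have [|//||r [w [w0 Uw dw _]]] := @eliminate_variables i0 (predC1 i0) 0 u.
- by [].
- by rewrite expr0 mul1r.
have [|||d [v [v0 Uv dv0 dv]]] := @eliminate_variables i1 (pred1 i0) 0 ('X_i0 ^+ r * w).
- by [].
- by rewrite mulf_neq0 // expf_neq0 // -msize_poly_eq0 msizeX.
- by rewrite expr0 mul1r.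
have vE : v = (v@_0)%:MP.
  apply: mderiv_eq0_const => // i; have [->|i_i0] := eqVneq i i0; first exact: dv0 (eqxx _).
  apply: dv; rewrite mderivM dw ?mulr0 ?addr0 //.
  by rewrite mpolyXn mderivX mulmnE mnm1E eq_sym (negPf i_i0) mul0n scale0r mul0r.
have Ud : U 'X_[U_(i1) *+ d].
  apply: (UZ (c := v@_0)); first by apply: contraNneq v0 => v00; rewrite vE v00 mpolyC0.
  by rewrite -mul_mpolyC -vE -mpolyXn mulrC.
(* From the power of ['X_i1] the other monomials of degree [d] follow by induction on [d - m i1]. *)
exists d => m; have [N] := ubnP (d - m i1)%N.
elim: N m => // N IH m /ltnSE-leN md.
have mi1 : (m i1 <= d)%N by rewrite -md mdegE (bigD1 i1) //= leq_addr.
have [mi1d|ltmd] := eqVneq (m i1) d.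
  suff -> : m = (U_(i1) *+ d)%MM by [].
  apply/mnmP => i; rewrite mulmnE mnm1E; have [<-|ni] := eqVneq i1 i; first by rewrite mul1n.
  apply/eqP; rewrite mul0n; move/eqP: md; rewrite mdegE (bigD1 i1) //= mi1d -{2}[d]addn0 eqn_add2l.
  by rewrite sum_nat_eq0 => /forall_inP->; rewrite // eq_sym.
have {ltmd} ltmd : (m i1 < d)%N by rewrite ltn_neqAle ltmd.
have [j [j1 mj]] : exists j, j != i1 /\ m j != 0%N.
  have /existsP[j /andP[? ?]] : [exists j, (j != i1) && (m j != 0%N)]; last by exists j.
  rewrite -[X in is_true X]negbK negb_exists; apply/negP => /forallP m0.
  move: ltmd; rewrite -md mdegE (bigD1 i1) //= big1 ?addn0 ?ltnn // => j j1.
  by move: (m0 j); rewrite j1 /= negbK => /eqP.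
(* X_j d/dX_i1 sends the monomial of [m'] to (m i1 + 1) times that of [m], and this factor is
   nonzero in characteristic zero. *)
pose m' := (m - U_(j) + U_(i1))%MM.
have m'j : (m = m' - U_(i1) + U_(j))%MM by rewrite addmK submK // lep1mP.
have m'1 : m' i1 = (m i1).+1 by rewrite !mnmE eqxx (negPf j1) subn0 addn1.
have Um' : U 'X_[m'].
  apply: IH; first by rewrite m'1 subnS prednK // ?subn_gt0.
  rewrite mdegD mdeg1 -md -[in RHS](@submK _ U_(j) m) ?lep1mP //.
  by rewrite mdegD mdeg1.
have i1j : i1 != j by rewrite eq_sym.
have := Ushift i1j Um'; rewrite mderivX -scalerAr -mpolyXD [(U_(j) + _)%MM]addmC -m'j.
by apply: UZ; rewrite m'1 ((pcharf0P M).1 chM).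
Qed.
End LieStable.

(** * Independence from the Galois group *)

Section GaloisIndependence.
Variables (F K M : fieldType) (iota : {rmorphism F -> K}) (phi : {rmorphism F -> M}).
Variables (D : K -> K) (DM : M -> M) (dF : F -> F) (n' : nat) (a : nat -> F).
Local Notation n := n'.+2.
Variables (f : K) (y : 'I_n -> M).
Hypotheses (chM : [pchar M] =i pred0) (hD : is_derivation D) (hDM : is_derivation DM).
Hypotheses (iota_d : forall c, D (iota c) = iota (dF c)).
Hypotheses (phi_d : forall c, DM (phi c) = phi (dF c)).
Hypotheses (an0 : a n != 0) (f0 : f != 0).
Hypothesis Lf : \sum_(i < n.+1) iota (a i) * iter i D f = 0.
Hypothesis Ly : forall j, \sum_(i < n.+1) phi (a i) * iter i DM (y j) = 0.
Hypothesis wronskian_neq0 : \det (wronskian_mx DM y) != 0.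
Hypothesis constM : forall z, DM z = 0 -> exists c, z = phi c.
Hypothesis shear : forall (i j : 'I_n) (t : nat), i != j -> exists s : {rmorphism M -> M},
  [/\ forall z, s (DM z) = DM (s z), forall c, s (phi c) = phi c &
      forall l, s (y l) = y l - (if l == j then t%:R * y i else 0)].

Let hDt := derivation_on_total hD.
Let hDMt := derivation_on_total hDM.
Let sub_top := subring_total.

(** [f] and the [y j] live in fields related only through [F]. The variables of [linform] stand for
    the unknown constant coordinates of [f] in the basis [y]: [ev] evaluates in [K], [e] at this
    generic solution. *)
Let ev (q : {mpoly F[n]}) : K := mmap iota (fun i : 'I_n => iter i D f) q.
Let linform (v : 'I_n -> M) : {mpoly M[n]} := \sum_j v j *: 'X_j.
Let e (q : {mpoly F[n]}) : {mpoly M[n]} :=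
  mmap (@mpolyC n M \o phi) (fun l : 'I_n => linform (fun j => iter l DM (y j))) q.

Definition coef_derivation (u : {mpoly M[n]}) : {mpoly M[n]} :=
  \sum_(m <- msupp u) DM u@_m *: 'X_[m].
Let dZ := coef_derivation.

Lemma mcoeff_coef_derivation u m : (dZ u)@_m = DM u@_m.
Proof.
rewrite /dZ /coef_derivation raddf_sum /=.
under eq_bigr do rewrite mcoeffZ mcoeffX.
have [um|/memN_msupp_eq0 um] := boolP (m \in msupp u).
  rewrite (bigD1_seq m) ?msupp_uniq //= eqxx mulr1 big1 ?addr0 // => l lm.
  by rewrite (negPf lm) mulr0.
rewrite um (derivation_on0 (sub_top M) hDMt) big1_seq // => l /andP[_ ul].
by case: eqP => [lm|]; rewrite ?mulr0 // lm um (derivation_on0 (sub_top M) hDMt) mul0r.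
Qed.

Lemma coef_derivationD u v : dZ (u + v) = dZ u + dZ v.
Proof.
case: hDM => DD _; apply/mpolyP => m.
by rewrite mcoeffD !mcoeff_coef_derivation mcoeffD DD.
Qed.

Lemma coef_derivationM u v : dZ (u * v) = dZ u * v + u * dZ v.
Proof.
case: (hDM) => DD DM_; apply/mpolyP => m.
rewrite mcoeffD !mcoeff_coef_derivation !mcoeffM.
rewrite (derivation_on_sum (sub_top M) hDMt) // -big_split; apply: eq_bigr => k _ /=.
by rewrite DM_ !mcoeff_coef_derivation.
Qed.

Lemma coef_derivationC c : dZ c%:MP = (DM c)%:MP.
Proof.
apply/mpolyP => m; rewrite mcoeff_coef_derivation !mcoeffC.
by case: eqP => _; rewrite ?mulr1 // !mulr0 (derivation_on0 (sub_top M) hDMt).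
Qed.

Lemma coef_derivationZ c u : dZ (c *: u) = DM c *: u + c *: dZ u.
Proof. by rewrite -!mul_mpolyC coef_derivationM coef_derivationC. Qed.

Lemma coef_derivation_linform v : dZ (linform v) = linform (DM \o v).
Proof.
apply/mpolyP => m; rewrite mcoeff_coef_derivation /linform !raddf_sum /=.
rewrite (derivation_on_sum (sub_top M) hDMt) //; apply: eq_bigr => j _.
rewrite !mcoeffZ mcoeffX.
by case: eqP => _; rewrite ?mulr1 // !mulr0 (derivation_on0 (sub_top M) hDMt).
Qed.

Let e_C c : e c%:MP = (phi c)%:MP.
Proof. by rewrite /e mmapC. Qed.
Let e_X l : e 'X_l = linform (fun j => iter l DM (y j)).
Proof. by rewrite /e mmapX mmap1U. Qed.
Let e_D p q : e (p + q) = e p + e q. Proof. exact: rmorphD. Qed.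
Let e_M p q : e (p * q) = e p * e q. Proof. exact: rmorphM. Qed.

Let e_N p : e (- p) = - e p. Proof. exact: rmorphN. Qed.
Let e_Z c p : e (c *: p) = (phi c)%:MP * e p. Proof. exact: mmapZ. Qed.
Let e_sum (G : 'I_n -> {mpoly F[n]}) : e (\sum_i G i) = \sum_i e (G i).
Proof. by apply: (big_morph e) => //; apply: rmorph0. Qed.
Let ev_N p : ev (- p) = - ev p. Proof. exact: rmorphN. Qed.
Let ev_D p q : ev (p + q) = ev p + ev q. Proof. exact: rmorphD. Qed.
Let ev_M p q : ev (p * q) = ev p * ev q. Proof. exact: rmorphM. Qed.
Let ev_Z c p : ev (c *: p) = iota c * ev p. Proof. exact: mmapZ. Qed.
Let ev_sum (G : 'I_n -> {mpoly F[n]}) : ev (\sum_i G i) = \sum_i ev (G i).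
Proof. by apply: (big_morph ev) => //; apply: rmorph0. Qed.

(* The prolongation of the derivation to polynomials in [f, f', ..., f^(n-1)],
   compared with its image in the coordinates where the variables are constant. *)
Lemma prolong_derivation q : exists q', dZ (e q) = e q' /\ D (ev q) = ev q'.
Proof.
elim/mpoly_ring_ind: q => [c|l|p q [p' [dp Dp]] [q' [dq Dq]]|p q [p' [dp Dp]] [q' [dq Dq]]].
- by exists (dF c)%:MP; rewrite !e_C coef_derivationC phi_d /ev !mmapC iota_d.
- have ev_X (k : 'I_n) : ev 'X_k = iter k D f by rewrite /ev mmapX mmap1U.
  have [ltl|] := ltnP l.+1 n.
    exists 'X_(Ordinal ltl); rewrite !e_X coef_derivation_linform.
    by rewrite !ev_X /=.
  move=> le_nl; have lE : (l : nat) = n'.+1 by apply/eqP; rewrite eqn_leq -ltnS ltn_ord.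
  exists (- \sum_(i < n) (a i / a n) *: 'X_i).
  (* Stated for any field over [F], since the same elimination serves for the [y j] in [M] and for
     [f] in [K]. *)
  have solve (L : fieldType) (psi : {rmorphism F -> L}) (v : nat -> L) :
      \sum_(i < n.+1) psi (a i) * v i = 0 ->
      v n = - \sum_(i < n) psi (a i / a n) * v i.
    rewrite big_ord_recr /= addrC => /eqP; rewrite addr_eq0 => /eqP vn.
    apply: (mulfI (x := psi (a n))); first by rewrite fmorph_eq0.
    rewrite vn mulrN mulr_sumr; congr (- _); apply: eq_bigr => i _.
    by rewrite mulrA -rmorphM [a n * _]mulrC divfK.
  split.
    rewrite e_X coef_derivation_linform e_N e_sum /linform -sumrN.
    under [RHS]eq_bigr do rewrite e_Z e_X /linform mulr_sumr -sumrN.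
    rewrite exchange_big; apply: eq_bigr => j _ /=.
    rewrite lE -iterS (solve _ phi (fun i => iter i DM (y j)) (Ly j)) -sumrN scaler_suml.
    apply: eq_bigr => i _; by rewrite mul_mpolyC scalerA scaleNr.
  rewrite ev_X lE -iterS (solve _ iota (fun i => iter i D f) Lf) ev_N ev_sum.
  by congr (- _); apply: eq_bigr => i _; rewrite ev_Z ev_X.
- exists (p' + q'); rewrite !e_D coef_derivationD dp dq !ev_D.
  by case: hD => -> _; rewrite Dp Dq.
- exists (p' * q + p * q'); rewrite e_M e_D !e_M coef_derivationM dp dq ev_D !ev_M.
  by case: hD => _ ->; rewrite Dp Dq.
Qed.

Definition relation_span (u : {mpoly M[n]}) : Prop :=
  exists s : seq (M * {mpoly F[n]}),
    (forall p, p \in s -> ev p.2 = 0) /\ u = \sum_(p <- s) p.1 *: e p.2.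
Let J := relation_span.

Lemma relation_span0 : J 0.
Proof. by exists [::]; rewrite big_nil. Qed.

Lemma relation_spanD u v : J u -> J v -> J (u + v).
Proof.
move=> [s [Is ->]] [t [It ->]]; exists (s ++ t); rewrite big_cat; split=> // p.
by rewrite mem_cat => /orP[/Is|/It].
Qed.

Lemma relation_spanZ c u : J u -> J (c *: u).
Proof.
move=> [s [Is ->]]; exists [seq (c * p.1, p.2) | p <- s]; split.
  by move=> _ /mapP[p ps ->]; apply: (Is p).
by rewrite scaler_sumr big_map; apply: eq_bigr => p _; rewrite scalerA.
Qed.

Lemma relation_span_e q : ev q = 0 -> J (e q).
Proof.
move=> q0; exists [:: (1, q)]; rewrite big_seq1 scale1r; split=> // p.
by rewrite inE => /eqP->.
Qed.

(** If [ev q = 0], then the prolongation q' of q satisfies ev q' = D (ev q) = 0, so dZ (e q) = e q'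
    stays in the span. *)
Lemma relation_span_derivation u : J u -> J (dZ u).
Proof.
move=> [s [Is ->]]; elim: s Is => [|[c q] s IH] Is.
  rewrite big_nil -mpolyC0 coef_derivationC (derivation_on0 (sub_top M) hDMt) mpolyC0.
  exact: relation_span0.
rewrite big_cons coef_derivationD; apply: relation_spanD; last first.
  by apply: IH => p ps; apply: Is; rewrite inE ps orbT.
have q0 : ev q = 0 by apply: (Is (c, q)); rewrite mem_head.
rewrite coef_derivationZ /=; apply: relation_spanD; apply: relation_spanZ.
  exact: relation_span_e.
have [q' [-> Dq]] := prolong_derivation q; apply: relation_span_e.
by rewrite -Dq q0 (derivation_on0 (sub_top K) hDt).
Qed.

Definition constant_relation (u : {mpoly M[n]}) : Prop := J u /\ forall m, DM u@_m = 0.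
Let U := constant_relation.

(* A nonzero element of minimal support, normalised to have a coefficient 1,
   is killed by [dZ]. *)
Lemma constant_relation_neq0 u : J u -> u != 0 -> exists v, v != 0 /\ U v.
Proof.
have [N] := ubnP (size (msupp u)); elim: N u => // N IH u /ltnSE-leN Ju u0.
have [m0 um0] := mpoly_neq0_coef u0.
pose v := (u@_m0)^-1 *: u.
have Jv : J v by apply: relation_spanZ.
have v0 : v != 0 by rewrite scaler_eq0 invr_eq0 negb_or um0.
have [dv0|dv0] := eqVneq (dZ v) 0.
  by exists v; split=> //; split=> // m; rewrite -mcoeff_coef_derivation dv0 mcoeff0.
apply: (IH (dZ v)) => //; last exact: relation_span_derivation.
apply: leq_trans leN; have um0' : m0 \in msupp u by rewrite mcoeff_msupp.
rewrite -(prednK (n := size (msupp u))) ?ltnS; last by case: (msupp u) um0'.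
rewrite -(size_rem um0'); apply: uniq_leq_size => // m.
rewrite mcoeff_msupp mem_rem_uniq // inE mcoeff_coef_derivation mcoeffZ => dm.
have [mm0|_] /= := eqVneq m m0.
  by move: dm; rewrite mm0 mulVf // (derivation_on1 (sub_top M) hDMt) eqxx.
rewrite mcoeff_msupp; apply: contraNneq dm => ->.
by rewrite mulr0 (derivation_on0 (sub_top M) hDMt).
Qed.

Let hC := constants_subring hDM.

(** * Action of the transvections on constant relations *)

Section Shear.
Variables (i j : 'I_n).
Hypothesis ij : i != j.

Let tau (t : nat) : {mpoly M[n]} -> {mpoly M[n]} :=
  mmap (@mpolyC n M) (fun l => 'X_l + (if l == i then t%:R *: 'X_j else 0)).
(** [T] is [tau] with the integer [t] replaced by an indeterminate. *)
Let T : {mpoly M[n]} -> {poly {mpoly M[n]}} :=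
  mmap (polyC \o @mpolyC n M)
       (fun l => ('X_l)%:P + (if l == i then ('X_j)%:P * 'X else 0)).

Let T_horner t u : (T u).[t%:R] = tau t u.
Proof.
rewrite -[LHS]/(horner_eval _ _) rmorph_mmap; apply: eq_mmap => [c|l] /=.
  by rewrite /horner_eval hornerC.
rewrite /horner_eval; case: eqP => _; rewrite !hornerE //.
by rewrite mulr_natr scaler_nat.
Qed.

Let T_D p q : T (p + q) = T p + T q. Proof. exact: rmorphD. Qed.
Let T_M p q : T (p * q) = T p * T q. Proof. exact: rmorphM. Qed.

(** To first order in the parameter, the substitution is the identity plus the derivation X_j
    d/dX_i. The constant term is included for the induction on products. *)
Let T_coef u : (T u)`_0 = u /\ (T u)`_1 = 'X_j * u^`M(i).
Proof.
have T_C c : T c%:MP = c%:MP%:P by rewrite /T mmapC.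
have T_X l : T 'X_l = ('X_l)%:P + (if l == i then ('X_j)%:P * 'X else 0).
  by rewrite /T mmapX mmap1U.
move: (T) T_C T_X T_D T_M => T' T_C T_X T_D' T_M'.
elim/mpoly_ring_ind: u => [c|l|p q [p0 p1] [q0 q1]|p q [p0 p1] [q0 q1]].
- by rewrite T_C !coefC mderivC mulr0.
- rewrite T_X mderivX mnm1E !coefD !coefC /=.
  have [->|li] := eqVneq l i.
    rewrite !coefMX !coefC /= add0r addr0; split=> //.
    have -> : (U_(i) - U_(i) = 0 :> 'X_{1..n})%MM by apply/mnmP => k; rewrite mnmBE subnn mnm0E.
    by rewrite scale1r mpolyX0 mulr1.
  by rewrite !coef0 !addr0 scale0r mulr0.
- by rewrite T_D' !coefD p0 p1 q0 q1 mderivD mulrDr.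
- rewrite T_M' !coefM !big_ord_recl !big_ord0 /= p0 p1 q0 q1.
  by rewrite mderivM mulrDr !addr0 addrC !mulrA [p * 'X_j]mulrC.
Qed.

Let tauZ t c u : tau t (c *: u) = c *: tau t u.
Proof. by rewrite /tau mmapZ mul_mpolyC. Qed.

Let tauX t l : tau t 'X_l = 'X_l + (if l == i then t%:R *: 'X_j else 0).
Proof. by rewrite /tau mmapX mmap1U. Qed.
Let tau_sum (I : Type) (r : seq I) t (G : I -> {mpoly M[n]}) :
  tau t (\sum_(l <- r) G l) = \sum_(l <- r) tau t (G l).
Proof. by apply: (big_morph (tau t)); [exact: rmorphD|exact: rmorph0]. Qed.

Let tau_linform t v : tau t (linform v) = linform v + v i *: (t%:R *: 'X_j).
Proof.
rewrite /linform tau_sum.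
under eq_bigr => l _ do rewrite tauZ tauX scalerDr.
rewrite big_split /=; congr (_ + _); rewrite (bigD1 i) //= eqxx big1 ?addr0 // => l li.
by rewrite (negPf li) scaler0.
Qed.

(** The form sum_l y_l Z_l is unchanged when y_j becomes y_j - t y_i and Z_i becomes Z_i + t Z_j, so
    [tau t] after [sg] fixes every [e q]. As [sg] fixes the constant coefficients of [u], [tau t u]
    is the combination for [u] with [sg] applied to its scalars. *)
Lemma shear_relation_span t u : U u -> J (tau t u).
Proof.
move=> [[s [Is uE]] constu]; have [sg [sgD sgphi sgy]] := shear t ij.
have map_lin v : map_mpoly sg (linform v) = linform (fun k => sg (v k)).
  rewrite /linform (big_morph (map_mpoly sg) (id1 := 0) (op1 := +%R)).
  - by apply: eq_bigr => k _; rewrite map_mpolyZ map_mpolyX.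
  - exact: rmorphD.
  - exact: rmorph0.
have tau_sg q : tau t (map_mpoly sg (e q)) = e q.
  rewrite /tau [map_mpoly _ _]rmorph_mmap [LHS]rmorph_mmap; apply: eq_mmap => [c|l] /=.
    by rewrite map_mpolyC mmapC; apply: (congr1 (@mpolyC n M) (sgphi c)).
  rewrite -/(tau t) map_lin.
  have sg_iter k : sg (iter l DM (y k)) = iter l DM (y k)
      - (if k == j then t%:R * iter l DM (y i) else 0).
    case: hDM => DD DM_; elim: (l : nat) => [|r IH] /=; first exact: sgy.
    rewrite sgD IH DD (derivation_onN (sub_top M) hDMt) //; congr (_ - _).
    case: ifP => _; last exact: derivation_on0 (sub_top M) hDMt.
    have -> : DM (t%:R * iter r DM (y i)) = t%:R * DM (iter r DM (y i)); last by [].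
    rewrite DM_; have -> : DM t%:R = 0; last by rewrite mul0r add0r.
    by apply: (subring_mulrn hC); case: hC => _ [].
  rewrite tau_linform sg_iter (negPf ij) subr0 /linform.
  under eq_bigr do rewrite sg_iter scalerBl.
  rewrite sumrB [X in _ - X](bigD1 j) //= eqxx.
  rewrite [X in _ - (_ + X)]big1 => [|k kj]; last by rewrite (negPf kj) scale0r.
  by rewrite addr0 scalerA mulrC subrK.
have -> : tau t u = tau t (map_mpoly sg u).
  congr (tau t _); apply/mpolyP => m; rewrite mcoeff_map_mpoly.
  by have [c ->] := constM (constu m); apply: esym (sgphi c).
exists [seq (sg p.1, p.2) | p <- s]; split.
  by move=> _ /mapP[p ps ->]; apply: (Is p).
rewrite uE raddf_sum tau_sum big_map; apply: eq_bigr => p _ /=.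
by rewrite map_mpolyZ tauZ tau_sg.
Qed.

(** [T u] takes values in [J] at all natural numbers, so by interpolation its coefficient of degree
    1 lies in [J]. *)
Lemma constant_relation_lie u : U u -> U ('X_j * u^`M(i)).
Proof.
move=> Uu; split.
  have [_ <-] := T_coef u.
  apply: (coef_in_submodule chM relation_spanD relation_spanZ (N := 0)) => t _.
  by rewrite T_horner; apply: shear_relation_span.
case: Uu => _ cu m; rewrite mcoeffM; have [C0 [C1 [_ [_ CM]]]] := hC.
apply: (subring_sum hC) => k _; apply: CM.
  by rewrite mcoeffX; case: eqP.
by rewrite mcoeff_mderiv; apply: (subring_mulrn hC).
Qed.
End Shear.

(** The inverse linear substitution, available because the Wronskian is nonzero: it recovers
    [map_mpoly phi q] from [e q]. *)
Let rho : {mpoly M[n]} -> {mpoly M[n]} :=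
  mmap (@mpolyC n M) (fun j => linform (fun l => invmx (wronskian_mx DM y) j l)).

Let rhoZ c u : rho (c *: u) = c *: rho u.
Proof. by rewrite /rho mmapZ mul_mpolyC. Qed.
Let rhoX j : rho 'X_j = linform (fun l => invmx (wronskian_mx DM y) j l).
Proof. by rewrite /rho mmapX mmap1U. Qed.
Let rho_sum (I : Type) (r : seq I) (G : I -> {mpoly M[n]}) :
  rho (\sum_(l <- r) G l) = \sum_(l <- r) rho (G l).
Proof. by apply: (big_morph rho); [exact: rmorphD|exact: rmorph0]. Qed.

Let rho_e q : rho (e q) = map_mpoly phi q.
Proof.
rewrite /rho /e rmorph_mmap; apply: eq_mmap => [c|l] /=; first by rewrite mmapC.
rewrite [LHS]rho_sum.
under eq_bigr => j _ do rewrite rhoZ rhoX /linform scaler_sumr.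
rewrite exchange_big /=.
have Wu : wronskian_mx DM y \in unitmx by rewrite unitmxE unitfE.
under eq_bigr => k _.
  under eq_bigr do rewrite scalerA.
  rewrite -scaler_suml.
  have -> : \sum_j iter l DM (y j) * invmx (wronskian_mx DM y) j k = (l == k)%:R.
    have := congr1 (fun A : 'M_n => A l k) (mulmxV Wu); rewrite !mxE => <-.
    by apply: eq_bigr => j _; rewrite mxE.
  over.
rewrite (bigD1 l) //= eqxx scale1r big1 ?addr0 // => k kl.
by rewrite eq_sym (negPf kl) scale0r.
Qed.

Lemma solution_algebraically_independent (Q : {mpoly F[n]}) :
  mmap iota (fun i : 'I_n => iter i D f) Q = 0 -> Q = 0.
Proof.
move=> evQ; apply/eqP/negPn/negP => Q0.
have eQ0 : e Q != 0.
  apply: contraNneq Q0 => eQ; have := rho_e Q; rewrite eQ [rho 0]rmorph0 => /esym/mpolyP Q0.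
  apply/eqP/mpolyP => m; apply: (fmorph_inj phi).
  by rewrite -mcoeff_map_mpoly Q0 !mcoeff0 rmorph0.
have [v [v0 Uv]] := constant_relation_neq0 (relation_span_e evQ) eQ0.
have UZ (c : M) m : c != 0 -> U (c *: 'X_[m]) -> U 'X_[m].
  move=> c0 [Jm _]; split=> [|l].
    by rewrite -(scale1r 'X_[m]) -(mulVf c0) -scalerA; apply: relation_spanZ.
  by rewrite mcoeffX; case: hC => C0 [C1 _]; case: eqP.
have Ush i j u : i != j -> U u -> U ('X_j * u^`M(i)) by move=> ij; apply: constant_relation_lie.
have [d Ud] := contains_monomials chM UZ Ush v0 Uv.
(* This is the d-th power of sum_j y_j Z_j, homogeneous of degree d, so each of its monomials lies
   in [U]. *)
have [s [Is eE]] : J (e ('X_ord0 ^+ d)).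
  have : e ('X_ord0 ^+ d) \is d.-homog for mdeg.
    have -> : e ('X_ord0 ^+ d) = e 'X_ord0 ^+ d by exact: rmorphXn.
    have /(dhomogMn d) : e 'X_ord0 \is 1.-homog for mdeg; last by rewrite mul1n.
    by rewrite e_X rpred_sum // => j _; apply: dhomogZ; rewrite dhomogX; apply/eqP/mdeg1.
  move/dhomogP => hom; rewrite [e _]mpolyE big_seq.
  apply: submodule_sum => [||m /hom md]; [exact: relation_spanD|exact: relation_span0|].
  by apply: relation_spanZ; case: (Ud m md).
(* Applying [rho] writes X_0^d as an [M]-combination of relations over [F]; by descent it is itself
   a relation, that is f^d = 0. *)
have : ev ('X_ord0 ^+ d) = 0.
  apply: (@span_descent _ _ _ phi (fun q => ev q = 0) s) => //.
  - exact: rmorph0.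
  - by move=> p q p0 q0; rewrite ev_D p0 q0 addr0.
  - by move=> c p p0; rewrite ev_Z p0 mulr0.
  by rewrite -rho_e eE rho_sum; apply: eq_bigr => p _; rewrite rhoZ rho_e.
rewrite /ev rmorphXn /= mmapX mmap1U /= => /eqP.
by rewrite expf_eq0 (negPf f0) andbF.
Qed.
End GaloisIndependence.

(** * Finite differential modules and the theorem *)

Section FiniteModules.
Variables (K : fieldType) (D : K -> K) (k : K -> Prop).
Hypotheses (hD : is_derivation D) (hk : is_diff_subfield D k).

Let hk' : subring_prop k := subfield_subring hk.1.
Let hDt := derivation_on_total hD.

(** [g] lies in a [k]-span, stable under [D], of a finite family [v]. Arbitrary finite index types
    let sums and products use sum and product types. *)
Definition in_finite_diff_module (g : K) : Prop :=
  exists (I : finType) (v : I -> K) (B : I -> I -> K) (c : I -> K),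
  [/\ forall i j, k (B i j), forall i, k (c i),
      forall i, D (v i) = \sum_j B i j * v j & g = \sum_i c i * v i].

Lemma in_finite_diff_module_const c : k c -> in_finite_diff_module c.
Proof.
move=> kc; exists unit, (fun=> 1), (fun _ _ => 0), (fun=> c).
have sum_unit (G : unit -> K) : \sum_i G i = G tt.
  by rewrite (big_pred1 tt) // => -[].
split=> //; first by case: hk'.
  by move=> _; rewrite sum_unit mul0r (derivation_on1 (subring_total K) hDt).
by rewrite sum_unit mulr1.
Qed.

Lemma in_finite_diff_moduleD g h :
  in_finite_diff_module g -> in_finite_diff_module h -> in_finite_diff_module (g + h).
Proof.
have k0 : k 0 by case: hk'.
move=> [I [v [B [c [kB kc Dv ->]]]]] [J [w [A [d [kA kd Dw ->]]]]].
exists (I + J)%type, (fun x => match x with inl i => v i | inr j => w j end).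
exists (fun x y => match x, y with
  | inl i, inl i' => B i i' | inr j, inr j' => A j j' | _, _ => 0 end).
exists (fun x => match x with inl i => c i | inr j => d j end).
split.
- by case=> ? [].
- by case.
- case=> i; rewrite big_sumType /= ?Dv ?Dw.
    by rewrite [X in _ + X]big1 ?addr0 // => j _; rewrite mul0r.
  by rewrite [X in X + _]big1 ?add0r // => j _; rewrite mul0r.
- by rewrite big_sumType.
Qed.

(** By the Leibniz rule the products v_i w_j satisfy a system with matrix the Kronecker sum of [B]
    and [A]. *)
Lemma in_finite_diff_moduleM g h :
  in_finite_diff_module g -> in_finite_diff_module h -> in_finite_diff_module (g * h).
Proof.
case: (hk') => k0 [k1 [kD [_ kM]]].
move=> [I [v [B [c [kB kc Dv ->]]]]] [J [w [A [d [kA kd Dw ->]]]]].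
exists (I * J)%type, (fun x => v x.1 * w x.2).
exists (fun x y => B x.1 y.1 * (x.2 == y.2)%:R + (x.1 == y.1)%:R * A x.2 y.2).
exists (fun x => c x.1 * d x.2); split.
- have kb (b : bool) : k b%:R by case: b.
  by move=> x y; apply: (kD); apply: (kM).
- by move=> x; apply: (kM).
- case=> i j /=; case: hD => _ ->; rewrite Dv Dw.
  under [RHS]eq_bigr do rewrite mulrDl.
  rewrite big_split /=; congr (_ + _).
    rewrite mulr_suml -(pair_bigA _ (fun i' j' => B i i' * (j == j')%:R * (v i' * w j'))) /=.
    apply: eq_bigr => i' _; rewrite (bigD1 j) //= eqxx mulr1 mulrA big1 ?addr0 // => j' jj'.
    by rewrite eq_sym (negPf jj') mulr0 mul0r.
  rewrite mulr_sumr -(pair_bigA _ (fun i' j' => (i == i')%:R * A j j' * (v i' * w j'))) /=.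
  rewrite exchange_big; apply: eq_bigr => j' _ /=.
  rewrite (bigD1 i) //= eqxx mul1r mulrCA big1 ?addr0 // => i' ii'.
  by rewrite eq_sym (negPf ii') !mul0r.
- rewrite mulr_suml -(pair_bigA _ (fun i j => c i * d j * (v i * w j))) /=.
  apply: eq_bigr => i _; rewrite mulr_sumr; apply: eq_bigr => j _.
  by rewrite mulrACA.
Qed.

Lemma in_finite_diff_module_horner f (p : {poly K}) : in_finite_diff_module f ->
  (forall i, k p`_i) -> in_finite_diff_module p.[f].
Proof.
move=> mf; elim/poly_ind: p => [|p c IH] kp.
  by rewrite horner0; apply: in_finite_diff_module_const; case: hk'.
rewrite hornerMXaddC; apply: in_finite_diff_moduleD.
  apply: in_finite_diff_moduleM => //; apply: IH => i.
  by have := kp i.+1; rewrite coefD coefMX coefC /= addr0.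
apply: in_finite_diff_module_const.
by have := kp 0; rewrite coefD coefMX coefC /= add0r.
Qed.

(** The system is the companion one for f, f', ..., f^(n-1); an equation of order 0 forces f = 0. *)
Lemma in_finite_diff_module_solution n a f :
  op_over k n a -> apply_op D n a f = 0 -> in_finite_diff_module f.
Proof.
case: (hk') => k0 [k1 [kD [kN kM]]]; have [_ [_ [_ [_ [_ kV]]]]] := hk.1.
case: n => [|n] [ka an0].
  rewrite /apply_op big_ord1 /= => /eqP; rewrite mulf_eq0 (negPf an0) => /eqP->.
  exact: in_finite_diff_module_const.
rewrite /apply_op big_ord_recr /= addrC => /eqP; rewrite addr_eq0 => /eqP Df.
pose last_row (j : 'I_n.+1) := - (a j / a n.+1).
exists 'I_n.+1, (fun i : 'I_n.+1 => iter i D f).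
exists (fun i j : 'I_n.+1 => if i.+1 == n.+1 then last_row j else (j == i.+1 :> nat)%:R).
exists (fun i : 'I_n.+1 => (i == 0 :> nat)%:R); split.
- move=> i j; case: ifP => _; last by case: eqP.
  by apply/kN/kM; [apply: ka; exact: ltnW | apply/kV/ka].
- by move=> i; case: eqP.
- move=> i; rewrite -iterS; case: eqP => [[->]|/eqP ni].
    rewrite /= (canRL (mulKf an0) Df) mulrN mulr_sumr -sumrN.
    by apply: eq_bigr => j _; rewrite /last_row mulrA mulNr [_ * a j]mulrC.
  have lti : (i.+1 < n.+1)%N by rewrite ltn_neqAle ni ltn_ord.
  rewrite (bigD1 (Ordinal lti)) //= eqxx mul1r big1 ?addr0 // => j jn.
  by move: jn; rewrite -val_eqE /= => /negPf->; rewrite mul0r.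
- rewrite (bigD1 ord0) //= mul1r big1 ?addr0 // => j j0.
  by move: j0; rewrite -val_eqE /= => /negPf->; rewrite mul0r.
Qed.

(** Vanishing top coefficients are dropped until the leading one is nonzero. *)
Lemma diff_finite_of_relation N b g :
  (forall i, (i <= N)%N -> k (b i)) -> (exists i, (i <= N)%N && (b i != 0)) ->
  \sum_(i < N.+1) b i * iter i D g = 0 -> diff_finite D k g.
Proof.
elim: N => [|N IH] kb [i /andP[iN bi0]] rel.
  exists 0, b; split=> //; split=> //.
  by move: iN bi0; rewrite leqn0 => /eqP->.
have [bN0|bN0] := eqVneq (b N.+1) 0; last by exists N.+1, b.
apply: IH => [j jN||]; first exact/kb/leqW.
  exists i; rewrite bi0 andbT -ltnS ltn_neqAle iN andbT.
  by apply: contraNneq bi0 => ->; rewrite bN0.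
by move: rel; rewrite big_ord_recr /= bN0 mul0r addr0.
Qed.

Lemma in_finite_diff_module_diff_finite g : in_finite_diff_module g -> diff_finite D k g.
Proof.
case: (hk') => k0 [k1 [kD [kN kM]]].
move=> [I [v [B [c0 [kB kc0 Dv gE]]]]].
pose F := subfield_type hk.1; pose iota : {rmorphism F -> K} := \val.
have /choice[C CE] : forall m, exists c : I -> F, iter m D g = \sum_i iota (c i) * v i.
  elim=> [|m [c cE]].
    have /choice[c cE] := fun i => subfield_elt hk.1 (kc0 i).
    by exists c; rewrite /= gE; apply: eq_bigr => i _; rewrite /iota /= cE.
  have kd i : k (D (iota (c i)) + \sum_j iota (c j) * B j i).
    apply: (kD); first by apply: hk.2; apply: subfield_valP.
    by apply: (subring_sum hk') => j _; apply: (kM) => //; apply: subfield_valP.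
  have /choice[d dE] := fun i => subfield_elt hk.1 (kd i).
  exists d; rewrite iterS cE (derivation_on_sum (subring_total K) hDt) //.
  under [RHS]eq_bigr do rewrite /iota /= dE mulrDl mulr_suml.
  rewrite big_split [X in _ = _ + X]exchange_big -big_split; apply: eq_bigr => i _ /=.
  case: hD => _ ->; congr (_ + _); rewrite Dv mulr_sumr; apply: eq_bigr => j _.
  by rewrite mulrA.
(* The rows are coordinates of g, Dg, ..., D^N g on a family of N elements, so N + 1 rows have a
   nontrivial dependence over [F]. *)
pose N := #|I|; pose A := \matrix_(m < N.+1, i < N) C m (enum_val i).
have : kermx A != 0.
  by rewrite kermx_eq0 /row_free neq_ltn (leq_ltn_trans (rank_leq_col A)).
case/rowV0Pn => w /sub_kermxP wA w0.
apply: (@diff_finite_of_relation N (fun i => iota (w 0 (inord i)))).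
- by move=> i _; apply: subfield_valP.
- have [i wi0] : exists i, w 0 i != 0.
    apply/existsP; rewrite -negb_forall; apply: contra w0 => /forallP w0.
    by apply/eqP/rowP => i; rewrite mxE; apply/eqP.
  by exists i; rewrite -ltnS ltn_ord inord_val fmorph_eq0.
under eq_bigr => m _ do rewrite inord_val CE mulr_sumr.
rewrite exchange_big big1 // => i _ /=.
under eq_bigr do rewrite mulrA -(rmorphM iota).
rewrite -mulr_suml -(rmorph_sum iota).
have -> : \sum_m w 0 m * C m i = 0; last by rewrite (rmorph0 iota) mul0r.
have /rowP/(_ (enum_rank i)) := wA; rewrite !mxE => wA0; rewrite -[RHS]wA0.
by apply: eq_bigr => m _; rewrite [A _ _]mxE enum_rankK.
Qed.
End FiniteModules.

Lemma in_kf_alg_dep (K : fieldType) (k : K -> Prop) f g :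
  is_subfield k -> in_kf k f g -> alg_dep k f g.
Proof.
move=> [k0 [k1 [_ [kN _]]]] [p [kp ->]]; exists ('X - p%:P).
split; first by rewrite polyXsubC_eq0.
split=> [i j|]; last first.
  rewrite size_XsubC !big_ord_recr big_ord0 /= !coefB !coefX !coefC /=.
  by rewrite sub0r subr0 expr0 hornerN hornerC expr1 mulr1 mul1r add0r addNr.
rewrite coefB coefX coefC; case: i => [|[|i]] /=.
- by rewrite sub0r coefN; apply: kN.
- by rewrite subr0 coef1; case: eqP.
- by rewrite subr0 coef0.
Qed.

(** Up to transposition the matrix is lower triangular with ones on the diagonal. *)
Lemma det_transvection (R : comNzRingType) n (i j : 'I_n) (c : R) :
  i != j -> \det (1%:M - c *: delta_mx i j) = 1.
Proof.
wlog: i j / (j < i)%N => [wl|ji _].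
  move=> ij; have [/wl|] := ltnP j i; first exact.
  rewrite leq_eqVlt => /orP[/eqP/val_inj ji|lt_ij]; first by rewrite ji eqxx in ij.
  by rewrite -det_tr linearB linearZ /= tr_scalar_mx trmx_delta wl // eq_sym.
rewrite det_trig; last first.
  apply/is_trig_mxP => r l rl; rewrite !mxE -val_eqE /= (ltn_eqF rl) sub0r.
  case: eqP => [ri|_]; last by rewrite mulr0 oppr0.
  case: eqP => [lj|_]; last by rewrite mulr0 oppr0.
  by move: rl; rewrite ri lj ltnNge ltnW.
rewrite big1 // => l _; rewrite !mxE eqxx.
case: eqP => [->|_]; last by rewrite mulr0 subr0.
by rewrite -val_eqE /= gtn_eqF // mulr0 subr0.
Qed.

Theorem theorem3 (K : fieldType) (D : K -> K) (k : K -> Prop)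
  (n : nat) (a : nat -> K) (f : K) :
  [pchar K] =i pred0 ->
  is_derivation D ->
  is_diff_subfield D k ->
  alg_closed_sub k ->
  (forall x, D x = 0 -> k x) ->
  (2 <= n)%N ->
  op_over k n a ->
  f != 0 ->
  apply_op D n a f = 0 ->
  gal_SL_or_GL D k n a ->
  forall g, in_Af D k f g <-> in_kf k f g.
Proof.
move=> chK hD hk kcl constk n_ge2 hop f0 Lf gal g; split; last first.
  move=> kfg; split; last exact: in_kf_alg_dep hk.1 kfg.
  case: kfg => p [kp ->]; apply: in_finite_diff_module_diff_finite => //.
  apply: in_finite_diff_module_horner => //.
  exact: in_finite_diff_module_solution Lf.
case: n n_ge2 hop Lf gal => [|[|n]] // _ hop Lf [M [DM [phi [y [PV gal]]]]].
have [hDM [phiD [phiM [phi1 [phi_d [Ly [W0 [constM _]]]]]]]] := PV.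
pose F := subfield_type hk.1; pose iota : {rmorphism F -> K} := \val.
have kF (c : F) : k (iota c) := subfield_valP c.
(* [phi] is a morphism on [k] only, so it is restricted to the field [F] to become a ring
   morphism. *)
have psi_zmod : zmod_morphism (fun c : F => phi (iota c)).
  move=> c d; apply/eqP; rewrite eq_sym subr_eq -phiD //.
  by rewrite -(rmorphD iota) subrK.
have psi_monoid : monoid_morphism (fun c : F => phi (iota c)).
  by split=> [|c d]; rewrite ?rmorph1 ?rmorphM ?phi1 ?phiM.
pose psi : {rmorphism F -> M} := HB.pack (fun c : F => phi (iota c))
  (GRing.isZmodMorphism.Build F M _ psi_zmod)
  (GRing.isMonoidMorphism.Build F M _ psi_monoid).
have psiE c : psi c = phi (iota c) by [].
have chM : [pchar M] =i pred0.
  by move=> p; rewrite (fmorph_pchar psi) -(fmorph_pchar iota) chK.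
have /choice[dF dFE] : forall c : F, exists d, iota d = D (iota c).
  by move=> c; apply: subfield_elt; apply: hk.2.
(* Only the coefficients up to the order are known to lie in [k]; beyond it [aF] takes the default
   value 0. *)
have /choice[aF aFE] : forall i, exists c : F, (i <= n.+2)%N -> iota c = a i.
  move=> i; have [i_n|_] := leqP i n.+2; last by exists 0.
  by have [c cE] := subfield_elt hk.1 (hop.1 i i_n); exists c.
apply: (@D_finite_algebraic_polynomial K F iota D k n a f) => //.
  move=> z; split=> [kz|[c <-]]; last exact: kF.
  exact: subfield_elt.
apply: (@solution_algebraically_independent F K M iota psi D DM dF n aF f y) => //.
- by move=> c; rewrite !psiE dFE phi_d.
- by rewrite -(fmorph_eq0 iota) aFE //; case: hop.
- by rewrite -[RHS]Lf; apply: eq_bigr => i _; rewrite aFE // -ltnS.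
- by move=> j; rewrite -[RHS](Ly j); apply: eq_bigr => i _; rewrite psiE aFE // -ltnS.
- by move=> z /constM[c [kc ->]]; have [d <-] := subfield_elt hk.1 kc; exists d.
(* This transvection has integer entries, hence constant ones, and determinant 1, so it belongs to
   the Galois group in both the SL and the GL case. *)
move=> i j t ij; pose A : 'M[F]_n.+2 := 1%:M - t%:R *: delta_mx i j.
have detA : \det (map_mx iota A) = 1 by rewrite det_map_mx det_transvection // rmorph1.
have hC := constants_subring hD.
have constA r l : D (map_mx iota A r l) = 0.
  have [_ [C1 [CD [CN CM]]]] := hC.
  rewrite !mxE rmorphB rmorphM !rmorph_nat; apply: CD.
    by apply: (subring_mulrn hC).
  by apply/CN/CM; apply: (subring_mulrn hC).
have [_ [sg [[sgD sgM _ sg_d sgphi] sgy]]] : in_diff_gal D k DM phi y (map_mx iota A).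
  case: gal => -> //; split=> //; by rewrite detA oner_neq0.
have sg_zmod : zmod_morphism sg.
  by move=> z w; apply/eqP; rewrite eq_sym subr_eq -sgD subrK.
have sg_monoid : monoid_morphism sg.
  by split=> //; rewrite -{1}phi1 sgphi ?phi1 //; have [_ []] := hk.1.
pose s : {rmorphism M -> M} := HB.pack sg
  (GRing.isZmodMorphism.Build M M _ sg_zmod)
  (GRing.isMonoidMorphism.Build M M _ sg_monoid).
exists s; split=> // [c|l]; first by rewrite psiE [s _]sgphi.
rewrite [s _]sgy.
under eq_bigr => r _ do rewrite mxE -psiE !mxE rmorphB rmorphM !rmorph_nat mulrBl.
rewrite sumrB; congr (_ - _).
  by rewrite (bigD1 l) //= eqxx mul1r big1 ?addr0 // => r rl; rewrite (negPf rl) mul0r.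
rewrite (bigD1 i) //= eqxx big1 => [|r ri]; last by rewrite (negPf ri) mulr0 mul0r.
by rewrite addr0; case: eqP => _; rewrite ?mulr1 // mulr0 mul0r.
Qed.
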